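(* Let $P$ be a finite $(\mathbf{3}+\mathbf{1})$-free poset and let $\lambda/\mu/d$ be a cylindric shape. Let $a_\nu$ denote the coefficients in the monomial expansion $s_{\lambda/\mu/d}(\mathbf{x})=\sum_\nu a_\nu m_\nu(\mathbf{x})$ and let $c^P_\nu$ denote the coefficients in $X_{\mathrm{inc}(P)}(\mathbf{x})=\sum_\nu c^P_\nu e_\nu(\mathbf{x})$. Then $$\sum_\nu a_\nu c^P_\nu=\langle\mathbf{u}_P\rangle\, s^P_{\lambda/\mu/d}(\mathbf{u})=\#\{T\in\mathrm{CT}_P(\lambda/\mu/d): T\text{ is standard}\},$$ where a cylindric $P$-tableau is standard if it contains each element of $P$ exactly once, and $\langle\mathbf{u}_P\rangle$ denotes taking the coefficient of the monomial $\mathbf{u}_P=\prod_{p\in P}u_p$.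
   Context: A poset is $(\mathbf{3}+\mathbf{1})$-free if it has no induced subposet isomorphic to the disjoint union of a 3-element chain and a single element. $\mathrm{inc}(P)$ is the incomparability graph of $P$ (vertices are the elements of $P$; edges join incomparable pairs). For a graph $G$, the chromatic symmetric function is $X_G(\mathbf{x})=\sum_\kappa\prod_{v\in V(G)}x_{\kappa(v)}$, over all proper colorings $\kappa:V(G)\to\mathbb{Z}_{>0}$. $m_\nu$ and $e_\nu$ are the monomial and elementary symmetric functions. Partitions are identified with Young diagrams $\{(i,j):1\le j\le\lambda_i\}$ in matrix (English) coordinates; $\lambda'$ is the transpose of $\lambda$; for $\mu\subset\lambda$, $\lambda/\mu$ is the set of boxes in $\lambda$ not in $\mu$. Parts with index beyond the length of a partition are $0$. $P$-tableaux: a function $T:\lambda/\mu\to P$ is a $P$-tableau of shape $\lambda/\mu$ if $T(i,j)<_P T(i+1,j)$ and $T(i,j)\not>_P T(i,j+1)$ whenever both boxes lie in $\lambda/\mu$. Cylindric $P$-tableaux: let $l=\lambda_1$. For $T:\lambda/\mu\to P$ and an integer $d\ge 0$, $T^d$ is the filling obtained by gluing a copy of the first column of $T$ to the right of the last column (column $l$), with the copy shifted up by $d$ cells. That is, $T^d$ has shape $\nu/\theta$ with $\nu'=(\lambda_1'+d,\dots,\lambda_l'+d,\lambda_1')$ and $\theta'=(\mu_1'+d,\dots,\mu_l'+d,\mu_1')$, with $T^d(r,c)=T(r-d,c)$ for $c\le l$ and $T^d(r,l+1)=T(r,1)$. A triple $\lambda/\mu/d$ with $\mu\subset\lambda$ is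 a cylindric shape if $\max(\lambda_1'-\lambda'_{\lambda_1},\ \mu_1'-\mu'_{\lambda_1})\le d\le\lambda_1'$. A cylindric $P$-tableau of shape $\lambda/\mu/d$ is a function $T:\lambda/\mu\to P$ such that $T^d$ is a $P$-tableau; $\mathrm{CT}_P(\lambda/\mu/d)$ is the set of these. When $P$ is the total order on $\mathbb{Z}_{>0}$, write $\mathrm{CSSYT}(\lambda/\mu/d)$ for this set. Cylindric Schur functions and $P$-analogs: $s_{\lambda/\mu/d}(\mathbf{x})=\sum_{T\in\mathrm{CSSYT}(\lambda/\mu/d)}\prod_{b\in\lambda/\mu}x_{T(b)}$, which is a symmetric function. For a finite poset $P$, let $\mathbb{Z}[\mathbf{u}]$ be the polynomial ring in commuting variables $u_p$, $p\in P$, and let $e_k^P(\mathbf{u})=\sum_{i_1<_P\cdots<_P i_k}u_{i_1}\cdots u_{i_k}$ (with $e_0^P=1$ and $e_k^P=0$ for $k<0$). Let $\psi:\Lambda(\mathbf{x})\to\mathbb{Z}[\mathbf{u}]$ be the ring homomorphism from the ring of symmetric functions (over $\mathbb{Z}$) with $\psi(e_k(\mathbf{x}))=e_k^P(\mathbf{u})$. The $P$-cylindric Schur function is $$s^P_{\lambda/\mu/d}(\mathbf{u}):=\psi(s_{\lambda/\mu/d}(\mathbf{x}))=\sum_{\substack{k_1+\cdots+k_{\lambda_1}=0\\ k_i\in\mathbb{Z}}}\det\left[e^P_{k_i(\lambda_1+d)+\lambda_i'-\mu_j'-i+j}(\mathbf{u})\right]_{i,j=1}^{\lambda_1},$$ the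 second equality being the known determinantal formula for cylindric Schur functions. *)

(* Defs.v *)
From HB Require Import structures.
From mathcomp Require Import all_boot all_order all_algebra.
From mathcomp Require Import finmap boolp classical_sets cardinality fsbigop.
From mathcomp Require Import monalg.

Set Implicit Arguments.
Unset Strict Implicit.
Unset Printing Implicit Defensive.

Import Order.TTheory GRing.Theory.

Local Open Scope ring_scope.

Record intpart := Intpart {
  parts :> seq nat;
  partsP : sorted geq parts && (0%N \notin parts) }.

HB.instance Definition _ := [isSub for parts].
HB.instance Definition _ := [Countable of intpart by <:].

(* Rows and columns are numbered from 1: [part la i] is la_i and [cpart la j]
   is la'_j, for i, j >= 1. *)
Definition part (la : intpart) (i : nat) : nat := nth 0%N la i.-1.
Definition cpart (la : intpart) (j : nat) : nat := count (leq j) la.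

Definition diagram (la : intpart) : {fset nat * nat} :=
  [fset b | b in [seq (i, j) | i <- iota 1 (size la),
                               j <- iota 1 (part la i)]]%fset.

Definition skew (la mu : intpart) : {fset nat * nat} :=
  (diagram la `\` diagram mu)%fset.

(* Here [part la 1] is la_1, the number l of columns.  If la is empty, both
   differences are 0 and the condition reads d = 0. *)
Definition cylindric_shape (la mu : intpart) (d : nat) : Prop :=
  [/\ (diagram mu `<=` diagram la)%fset,
      (cpart la 1 - cpart la (part la 1) <= d)%N,
      (cpart mu 1 - cpart mu (part la 1) <= d)%N
    & (d <= cpart la 1)%N].

Section Tableaux.
Context {disp : Order.disp_t} {P : porderType disp}.

(* A filling of a set of boxes, with [None] outside of this set. *)
Definition filling := nat -> nat -> option P.

Definition fill (D : {fset nat * nat}) (T : {ffun D -> P}) : filling :=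
  fun r c => omap T (insub (r, c)).

Definition is_tableau (F : filling) : Prop :=
  (forall r c x y, F r c = Some x -> F r.+1 c = Some y -> (x < y)%O) /\
  (forall r c x y, F r c = Some x -> F r c.+1 = Some y -> ~~ (y < x)%O).

(* The filling T^d, for a filling with l columns.  When r <= d, the truncated
   difference r - d is 0, which is not the index of a row. *)
Definition glue (l d : nat) (F : filling) : filling :=
  fun r c => if (c <= l)%N then F (r - d)%N c
             else if c == l.+1 then F r 1%N else None.

Definition is_cyl_tableau (la mu : intpart) (d : nat)
    (T : {ffun skew la mu -> P}) : Prop :=
  is_tableau (glue (part la 1) d (fill T)).

End Tableaux.

Arguments filling {disp} P.

Definition standard (disp : Order.disp_t) (P : porderType disp)
    (D : {fset nat * nat}) (T : {ffun D -> P}) : Prop :=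
  forall p : P, exists! b : D, T b = p.

(* Formal power series with integer coefficients in the variables x_i, i : nat;
   the index set nat stands for the positive integers, by a shift of indices. *)
Notation monom := {cmonom nat}.

Record series := Series { coef : monom -> int }.

HB.instance Definition _ := gen_eqMixin series.
HB.instance Definition _ := gen_choiceMixin series.

Lemma seriesP (f g : series) : coef f =1 coef g -> f = g.
Proof. by case: f g => f [g] /= /funext ->. Qed.

Definition series0 := Series (fun=> 0).
Definition series1 := Series (fun m => (m == mone)%:R).
Definition series_opp f := Series (fun m => - coef f m).
Definition series_add f g := Series (fun m => coef f m + coef g m).
Definition series_mul f g := Series (fun m =>
  \sum_(pq \in [set pq : monom * monom | mmul pq.1 pq.2 = m])
     coef f pq.1 * coef g pq.2).

(* The sum defining [series_mul] is finite: [mdivisors m] contains all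
   the divisors of m. *)
Definition mdivisors (m : monom) : {fset monom} :=
  [fset [cmonom nat_of_ord (h i) | i : finsupp m]%M
     | h : {ffun finsupp m -> 'I_(mdeg m).+1} in predT]%fset.

Lemma mdeg_ge (m : monom) i : (m i <= mdeg m)%N.
Proof.
case: (mdomP m i) => // im; rewrite mdegE (big_fsetD1 i) //=.
exact: leq_addr.
Qed.

Lemma mem_mdivisorsl p q : p \in mdivisors (mmul p q).
Proof.
pose m := mmul p q.
have le i : (p i < (mdeg m).+1)%N.
  by rewrite ltnS (leq_trans _ (mdeg_ge m i)) // cmM leq_addr.
apply/imfsetP; exists [ffun i : finsupp m => Ordinal (le (val i))] => //=.
apply/eqP/cmP => i; rewrite cmE /= fsfun_ffun.
case: insubP => [u _ <-|] /=; first by rewrite ffunE.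
by rewrite -/m mdomD in_fsetU negb_or => /andP[/fsfun_dflt].
Qed.

Lemma mem_mdivisorsr p q : q \in mdivisors (mmul p q).
Proof. by rewrite mulmC mem_mdivisorsl. Qed.

Lemma coef_mulE (D : {fset monom}) f g m :
    (forall p q, mmul p q = m -> (p \in D) && (q \in D)) ->
  coef (series_mul f g) m =
    \sum_(p <- D) \sum_(q <- D) coef f p * coef g q *+ (mmul p q == m).
Proof.
move=> hD; rewrite /series_mul; pose r := [seq (p, q) | p <- D, q <- D].
rewrite /= (fsbig_fwiden [seq pq <- r | mmul pq.1 pq.2 == m]) /=.
- rewrite big_filter big_mkcond big_allpairs.
  apply: eq_bigr => p _; apply: eq_bigr => q _ /=.
  by rewrite mulrb.
- case=> p q /= hm; have /andP[pD qD] := hD _ _ hm.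
  by rewrite mem_filter /= hm eqxx allpairs_f.
- by rewrite filter_uniq // allpairs_uniq // => -[? ?] [? ?].
- by case=> p q [/=]; rewrite mem_filter => /andP[/eqP /=].
Qed.

Lemma coef_mul f g m : coef (series_mul f g) m =
  \sum_(p <- mdivisors m) \sum_(q <- mdivisors m)
     coef f p * coef g q *+ (mmul p q == m).
Proof.
by apply: coef_mulE => p q <-; rewrite mem_mdivisorsl mem_mdivisorsr.
Qed.

Lemma sum_pred1 (D : {fset monom}) (a : monom) (F : monom -> int) :
  a \in D -> \sum_(p <- D) F p *+ (p == a) = F a.
Proof.
move=> aD; rewrite (big_fsetD1 a) //= eqxx big_seq big1 ?addr0 // => p.
by rewrite in_fsetD1 => /andP[/negbTE ->].
Qed.

Fact series_addA : associative series_add.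
Proof. by move=> f g h; apply/seriesP => m; exact: addrA. Qed.

Fact series_addC : commutative series_add.
Proof. by move=> f g; apply/seriesP => m; exact: addrC. Qed.

Fact series_add0 : left_id series0 series_add.
Proof. by move=> f; apply/seriesP => m; exact: add0r. Qed.

Fact series_addN : left_inverse series0 series_opp series_add.
Proof. by move=> f; apply/seriesP => m; exact: addNr. Qed.

HB.instance Definition _ := GRing.isZmodule.Build series
  series_addA series_addC series_add0 series_addN.

Fact series_mulC : commutative series_mul.
Proof.
move=> f g; apply/seriesP => m; rewrite !coef_mul exchange_big /=.
apply: eq_bigr => p _; apply: eq_bigr => q _.
by rewrite mulrC mulmC.
Qed.

Fact series_mul1 : left_id series1 series_mul.
Proof.
move=> f; apply/seriesP => m.
have mD := mem_mdivisorsr mone m; have oD := mem_mdivisorsl mone m.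
rewrite mul1m in mD oD.
rewrite coef_mul -[RHS](sum_pred1 _ mD) (big_fsetD1 mone) //=.
rewrite [X in _ + X](_ : _ = 0) ?addr0; last first.
  rewrite big_seq big1 // => p; rewrite in_fsetD1 => /andP[/negbTE -> _].
  by rewrite big1 // => q _; rewrite mul0r mul0rn.
by apply: eq_bigr => q _; rewrite eqxx mul1r mul1m.
Qed.

Fact series_mulDl : left_distributive series_mul series_add.
Proof.
move=> f g h; apply/seriesP => m.
rewrite [RHS](_ : _ = coef (series_mul f h) m + coef (series_mul g h) m) //.
rewrite !coef_mul -big_split /=.
apply: eq_bigr => p _; rewrite -big_split /=; apply: eq_bigr => q _.
by rewrite mulrDl mulrnDl.
Qed.

Lemma coef_mul3 f g h m : coef (series_mul (series_mul f g) h) m =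
  \sum_(p <- mdivisors m) \sum_(q <- mdivisors m) \sum_(r <- mdivisors m)
     coef f p * coef g q * coef h r *+ (mmul (mmul p q) r == m).
Proof.
rewrite coef_mul; set D := mdivisors m.
under [RHS]eq_bigr do rewrite exchange_big /=.
rewrite [RHS]exchange_big /= exchange_big /=; apply: eq_bigr => r _.
transitivity (\sum_(a <- D) \sum_(p <- D) \sum_(q <- D)
   coef f p * coef g q * coef h r *+ (mmul p q == a) *+ (mmul a r == m)).
  apply: eq_bigr => a _; case: (eqVneq (mmul a r) m) => [am|_]; last first.
    by rewrite mulr0n big1 // => p _; rewrite big1 // => q _; rewrite mulr0n.
  rewrite mulr1n -[X in X * _]/(coef (series_mul f g) a).
  rewrite (coef_mulE (D := D)) => [|p q pq].
    rewrite big_distrl /=; apply: eq_bigr => p _.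
    rewrite big_distrl /=; apply: eq_bigr => q _.
    by rewrite mulr1n mulrnAl.
  rewrite /D -am -pq -mulmA mem_mdivisorsl mulmA (mulmC p) -mulmA.
  by rewrite mem_mdivisorsl.
rewrite exchange_big /=; apply: eq_bigr => p _.
rewrite exchange_big /=; apply: eq_bigr => q _.
case: (eqVneq (mmul (mmul p q) r) m) => [pqm|npqm].
  have aD : mmul p q \in D by rewrite /D -pqm mem_mdivisorsl.
  rewrite (big_fsetD1 _ aD) /= eqxx pqm eqxx big_seq big1 ?addr0 // => a.
  by rewrite in_fsetD1 eq_sym => /andP[/negbTE ->]; rewrite mulr0n mul0rn.
rewrite big1 // => a _; case: eqVneq => [<-|_]; last by rewrite mulr0n mul0rn.
by rewrite (negbTE npqm) mulr0n.
Qed.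

Fact series_mulA : associative series_mul.
Proof.
move=> f g h; rewrite [LHS]series_mulC; apply/seriesP => m; rewrite !coef_mul3.
under eq_bigr do rewrite exchange_big /=.
rewrite exchange_big /=; apply: eq_bigr => p _; apply: eq_bigr => q _.
apply: eq_bigr => r _.
by rewrite mulrC mulmC mulmA mulrA.
Qed.

Fact series_1neq0 : series1 != series0.
Proof. by apply/eqP => /(congr1 (coef^~ mone)); rewrite /= eqxx. Qed.

HB.instance Definition _ := GRing.Zmodule_isComNzRing.Build series
  series_mulA series_mulC series_mul1 series_mulDl series_1neq0.

Definition invariant_series (f : series) : Prop :=
  forall (s : nat -> nat) (m m' : monom), bijective s ->
    (forall i, m' i = m (s i)) -> coef f m' = coef f m.

Definition bounded_series (f : series) : Prop :=
  exists d, forall m, (d < mdeg m)%N -> coef f m = 0.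

Definition symmetric_series : {pred series} :=
  [pred f | `[< invariant_series f /\ bounded_series f >]].

Lemma invariant_mul f g :
  invariant_series f -> invariant_series g -> invariant_series (f * g).
Proof.
move=> If Ig s m m' bs mE; have [t st ts] := bs.
pose act (u v : nat -> nat) (p : monom) : monom :=
  [cmonom p (u i) | i in [fset v j | j in finsupp p]%fset]%M.
have actE u v p i : cancel u v -> act u v p i = p (u i).
  move=> uv; rewrite /act cmE fsfun_fun; case: ifP => // /negbT niP.
  apply/esym/eqP; rewrite cmE_eq0; apply: contra niP => ui.
  by apply/imfsetP; exists (u i) => //=; rewrite uv.
have actM u v p q : cancel u v ->
    mmul (act u v p) (act u v q) = act u v (mmul p q).
  by move=> uv; apply/eqP/cmP => i; rewrite cmM !actE // cmM.
have actK u v : cancel u v -> cancel v u -> cancel (act u v) (act v u).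
  by move=> uv vu p; apply/eqP/cmP => i; rewrite !actE // vu.
have m'E : m' = act s t m by apply/eqP/cmP => i; rewrite actE.
rewrite [LHS](reindex_fsbig (fun pq => (act s t pq.1, act s t pq.2))
  [set pq : monom * monom | mmul pq.1 pq.2 = m]) /=; last first.
  split.
  - by case=> p q /= pq; rewrite actM // pq m'E.
  - case=> p q [p' q'] _ _ /= [/(can_inj (actK _ _ st ts)) -> ].
    by move=> /(can_inj (actK _ _ st ts)) ->.
  - case=> p q /= pq; exists (act t s p, act t s q) => /=.
      by rewrite actM // pq m'E actK.
    by rewrite !actK.
apply: eq_fsbigr => -[p q] _ /=; congr (_ * _).
  by apply: (If s) => // i; rewrite actE.
by apply: (Ig s) => // i; rewrite actE.
Qed.

Lemma bounded_mul f g :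
  bounded_series f -> bounded_series g -> bounded_series (f * g).
Proof.
move=> [d df] [e eg]; exists (d + e)%N => m dm; apply: fsbig1 => -[p q] /= pq.
case: (ltnP d (mdeg p)) => [/df ->|pd]; first by rewrite mul0r.
rewrite [coef g q]eg ?mulr0 // ltnNge; apply/negP => qe.
by move: dm; rewrite -pq mdegM ltnNge leq_add.
Qed.

Fact symmetric_subring : subring_closed symmetric_series.
Proof.
split.
- apply/asboolP; split.
    move=> s m m' bs mE /=; congr (nat_of_bool _)%:R.
    apply/cmP/cmP => h i; rewrite cm1.
      by have [t _ ts] := bs; rewrite -(ts i) -mE h cm1.
    by rewrite mE h cm1.
  by exists 0%N => m; rewrite /=; case: eqP => // ->; rewrite mdeg1.
- move=> f g /asboolP[If [d df]] /asboolP[Ig [e eg]]; apply/asboolP; split.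
    move=> s m m' bs mE; rewrite [LHS]/= [RHS]/=.
    by congr (_ - _); [apply: (If s)|apply: (Ig s)].
  exists (maxn d e) => m; rewrite gtn_max => /andP[dm em].
  by rewrite [LHS]/= df // eg // subr0.
- move=> f g /asboolP[If bf] /asboolP[Ig bg]; apply/asboolP; split.
    exact: invariant_mul.
  exact: bounded_mul.
Qed.

HB.instance Definition _ :=
  GRing.isSubringClosed.Build series symmetric_series symmetric_subring.

Record symfun := Symfun {
  symfun_series :> series;
  symfunP : symfun_series \in symmetric_series }.

HB.instance Definition _ := [isSub for symfun_series].
HB.instance Definition _ := [Choice of symfun by <:].
HB.instance Definition _ := [SubChoice_isSubComNzRing of symfun by <:].

(* m_nu is the sum of the monomials whose nonzero exponents are, up to order,
   the parts of nu. *)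
Definition msf (nu : intpart) : series :=
  Series (fun m => (perm_eq [seq m i | i <- finsupp m] nu)%:R).

(* e_k is the sum of the squarefree monomials of degree k. *)
Definition esf_coef (k : nat) (m : monom) : int :=
  (all [pred i | m i == 1%N] (finsupp m) && (mdeg m == k))%:R.

Fact esf_symmetric k : Series (esf_coef k) \in symmetric_series.
Proof.
apply/asboolP; split; last first.
  by exists k => m km; rewrite /= /esf_coef gtn_eqF ?andbF.
move=> s m m' bs mE; congr (nat_of_bool _)%:R => /=; have [t st ts] := bs.
have suppE : finsupp m = [fset s i | i in finsupp m']%fset.
  apply/fsetP => i; apply/idP/imfsetP => /= [im|[j jm ->]].
    by exists (t i); rewrite ?ts // -cmE_neq0 mE ts cmE_neq0.
  by rewrite -cmE_neq0 -mE cmE_neq0.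
congr (_ && _).
  apply/allP/allP => /= h i.
    by move=> im; rewrite -(ts i) -mE h // -cmE_neq0 mE ts cmE_neq0.
  by move=> im; rewrite mE h // -cmE_neq0 -mE cmE_neq0.
congr (_ == k); rewrite !mdegE suppE big_imfset /=.
  by apply: eq_bigr => i _; rewrite mE.
by move=> i j _ _; exact: (bij_inj bs).
Qed.

Definition esf (k : nat) : symfun := Symfun (esf_symmetric k).

Definition esf_part (nu : intpart) : symfun := \prod_(k <- nu) esf k.

(* The generating series \sum_(t in A) x^(w t).  It is meaningful only if each
   weight is taken by finitely many elements of A: a [\sum_(_ \in _)] with
   infinite support is 0. *)
Definition gen_series (T : choiceType) (A : set T) (w : T -> monom) : series :=
  Series (fun m => \sum_(t \in A) ((w t == m)%:R : int)).

Definition monom_of (I : finType) (V : choiceType) (f : I -> V) : {cmonom V} :=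
  \big[mmul/mone]_(i : I) ucm (f i).

Definition proper_coloring (V : finType) (e : rel V) (k : {ffun V -> nat}) :=
  forall u v, e u v -> k u != k v.

Definition chromatic_series (V : finType) (e : rel V) : series :=
  gen_series [set k | proper_coloring e k] (fun k => monom_of k).

Definition cyl_schur (la mu : intpart) (d : nat) : series :=
  gen_series [set T : {ffun skew la mu -> nat} | is_cyl_tableau d T]
    (fun T => monom_of T).

Section PosetAnalogs.
Context {disp : Order.disp_t} (P : finPOrderType disp).

Definition inc : rel P := fun p q => (p >< q)%O.

Definition three_plus_one_free : Prop :=
  ~ exists a b c x : P,
      [/\ (a < b)%O, (b < c)%O & [/\ (x >< a)%O, (x >< b)%O & (x >< c)%O]].

Definition esfP (k : nat) : {malg int[{cmonom P}]} :=
  \sum_(t : k.-tuple P | sorted <%O t) \prod_(p <- t) << ucm p >>.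

(* The image of [cyl_schur] by a map psi defined on symmetric functions.
   Cylindric Schur functions are symmetric, so that the default value of
   [insubd] plays no role. *)
Definition cyl_schurP (psi : symfun -> {malg int[{cmonom P}]})
    (la mu : intpart) (d : nat) : {malg int[{cmonom P}]} :=
  psi (insubd 0 (cyl_schur la mu d)).

Definition uP : {cmonom P} := monom_of (fun p : P => p).

Definition nb_standard_cyl (la mu : intpart) (d : nat) : nat :=
  #|[pred T : {ffun skew la mu -> P} |
      `[< is_cyl_tableau d T /\ standard T >] ]|.

End PosetAnalogs.

Arguments inc {disp} P.

(* Main.v *)
Require Import Defs.
From HB Require Import structures.
From mathcomp Require Import all_boot all_order all_algebra.
From mathcomp Require Import perm finmap boolp fsbigop monalg zify.

Set Implicit Arguments.
Unset Strict Implicit.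
Unset Printing Implicit Defensive.

Import Order.TTheory GRing.Theory.

(** The three numbers agree because all of them can be computed from one signed
    expansion of the cylindric Schur function in elementary symmetric functions,
    s = \sum_n sgn n * \prod_c e_(n c).  Here n assigns a length to each of the
    l columns and sgn n is the determinant of a 0/1 matrix recording which
    column feet are congruent modulo l + d; this is the Jacobi-Trudi formula for
    cylindric shapes, with the sum over translations absorbed in the congruence.

    The formula and its analog for a poset Q have a common proof.  Expanding
    each e_k^Q into chains turns the right-hand side into a signed count of
    cyclic arrays of l chains.  If an array is not a cylindric tableau and has a
    nonzero sign, then it has a flaw: an entry whose left neighbour is missing
    or larger.  Exchanging the tails of two adjacent columns at a flaw exchanges
    two rows of the sign matrix, hence changes the sign, and this should be an
    involution, as in Gasharov's proof for ordinary shapes.  The difficulty is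
    the canonical choice of the flaw: for an ordinary shape one takes a topmost
    one, but on a cylinder no row is the topmost one.  Instead, every flaw
    receives a key, read off from the ranks of the last two entries that stay in
    place, and the swap is done at a flaw of smallest key.  All entries moved by
    the swap are greater than these two, so that only flaws of larger key are
    created or destroyed; the one delicate case is settled by applying
    (3+1)-freeness twice ([flaw_swap_low]).  Hence the arrays with a flaw cancel
    ([sum_flawed_eq0]), and those without a flaw and with a nonzero sign are the
    cylindric tableaux ([jacobi_trudi_tableaux]).

    For Q = 'I_k with k arbitrary this says that the cylindric Schur function is
    the signed sum of products of the e_k ([cyl_schur_jacobi_trudi]), so that
    psi sends it to the signed sum of products of the e_k^P; for Q = P it says
    that the coefficient of u_P in the latter counts standard tableaux.  This is
    the second equality.

    For the first one, the coefficient of x^nu in \prod_c e_(n c) is the number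
    of 0/1 matrices with row sums n and column sums nu, so that it is symmetric
    in n and nu ([coef_prod_esf_sym]).  Therefore \sum_nu a_nu c_nu is the
    signed sum over n of the coefficients of x^n in \sum_nu c_nu e_nu, which is
    X_inc(P).  Such a coefficient counts the ordered partitions of P into chains
    of sizes n c, and so it is the coefficient of u_P in \prod_c e_(n c)^P
    ([coef_chromatic]). *)

(** * The rank of an element of a (3+1)-free poset *)
Section Rank.
Context {disp : Order.disp_t} (Q : finPOrderType disp).
Implicit Types p q r : Q.

(** Ranking by the size of the strict upper set, and not by a mere linear
    extension, is what provides the element s of [rank_witness]. *)
Definition rank p : nat := #|[pred q | ~~ (p < q)%O]|.

Lemma rank_lt p q : (p < q)%O -> rank p < rank q.
Proof.
move=> pq; apply: proper_card; apply/properP; split.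
  by apply/subsetP => r; rewrite !inE; apply: contra; apply: lt_trans.
by exists q; rewrite !inE ?ltxx // negbK.
Qed.

Lemma rank_witness p q r : rank p <= rank q -> (q < r)%O -> ~~ (p < r)%O ->
  exists2 s, (p < s)%O & ~~ (q < s)%O.
Proof.
move=> pq qr pr; apply/exists_inP; apply: contraTT pq.
rewrite -ltnNge => /exists_inPn h.
apply: proper_card; apply/properP; split; last by exists r; rewrite !inE ?negbK.
apply/subsetP => s; rewrite !inE => qs; apply/negP => ps.
by have := h _ ps; rewrite qs.
Qed.

Hypothesis Q_free : three_plus_one_free Q.

(** The two negated inequalities already force s to be incomparable to the chain
    p < q < r, which is the form in which (3+1)-freeness gets used. *)
Lemma no_three_plus_one p q r s : (p < q)%O -> (q < r)%O ->
  ~~ (p < s)%O -> ~~ (s < r)%O -> false.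
Proof.
move=> pq qr ps sr; case: Q_free; exists p, q, r, s.
have pr := lt_trans pq qr.
have N1 : ~~ (s <= p)%O by apply: contra sr => /le_lt_trans; apply.
have N2 : ~~ (r <= s)%O by apply: contra ps => /(lt_le_trans pr).
have N3 : ~~ (q <= s)%O by apply: contra ps => /(lt_le_trans pq).
have N4 : ~~ (s <= q)%O by apply: contra sr => /le_lt_trans; apply.
have N5 : ~~ (p <= s)%O.
  by rewrite le_eqVlt negb_or ps andbT; apply: contra sr => /eqP <-.
have N6 : ~~ (s <= r)%O.
  by rewrite le_eqVlt negb_or sr andbT; apply: contra ps => /eqP ->.
split=> //; split; rewrite /Order.comparable negb_or;
  by rewrite ?N1 ?N2 ?N3 ?N4 ?N5 ?N6.
Qed.

End Rank.

(** * Chains as partial functions on positions *)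
Section SortedOnth.
Context {disp : Order.disp_t} {Q : porderType disp}.
Implicit Types s t : seq Q.

Lemma onth_size (T : Type) (s : seq T) i x : onth s i = Some x -> i < size s.
Proof. by move=> e; rewrite -onthTE e. Qed.

Lemma onth_lt (T : Type) (s : seq T) i :
  i < size s -> exists x, onth s i = Some x.
Proof. by rewrite -onthTE; case: onth => // x _; exists x. Qed.

Lemma onth_below (T : Type) (s : seq T) i j y :
  i <= j -> onth s j = Some y -> exists x, onth s i = Some x.
Proof. by move=> ij e; apply/onth_lt/(leq_ltn_trans ij (onth_size e)). Qed.

Lemma onth_take (T : Type) (s : seq T) i j :
  onth (take i s) j = if j < i then onth s j else None.
Proof.
elim: s i j => [|x s IH] [|i] [|j] //=; first by rewrite if_same.
by rewrite IH.
Qed.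

Lemma onth_drop (T : Type) (s : seq T) i j : onth (drop i s) j = onth s (i + j).
Proof. by elim: s i => [|x s IH] [|i] //=; rewrite ?addSn ?IH ?onth0n. Qed.

Lemma sorted_onthS s :
    (forall i x y, onth s i = Some x -> onth s i.+1 = Some y -> (x < y)%O) ->
  sorted <%O s.
Proof.
case: s => // x s h; apply/(pathP x) => i si /=.
apply: (h i); last by rewrite onthE (nth_map x).
by rewrite (onthE (x :: s)) (nth_map x) //= ltnW.
Qed.

Lemma sorted_onth s : reflect
  (forall i j x y, i < j -> onth s i = Some x -> onth s j = Some y -> (x < y)%O)
  (sorted <%O s).
Proof.
apply: (iffP idP) => [ss i j x y ij ex ey|h].
  rewrite -(@onth_nth _ x _ _ _ ex) -(@onth_nth _ x _ _ _ ey).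
  by rewrite (sorted_ltn_nth lt_trans) ?inE ?(onth_size ex) ?(onth_size ey).
by apply: sorted_onthS => i x y; apply: h.
Qed.

Lemma onth_sorted_lt s i j x y : sorted <%O s -> i < j ->
  onth s i = Some x -> onth s j = Some y -> (x < y)%O.
Proof. by move=> /sorted_onth; apply. Qed.

Lemma onth_sorted_le s i j x y : sorted <%O s -> i <= j ->
  onth s i = Some x -> onth s j = Some y -> (x <= y)%O.
Proof.
move=> ss; rewrite leq_eqVlt => /predU1P[->|ij]; first by move=> -> [->].
by move=> ex ey; rewrite ltW // (onth_sorted_lt ss ij ex ey).
Qed.

End SortedOnth.

(** * Flaws and tail swaps in cyclic arrays of chains *)
Section Flaws.
Context {disp : Order.disp_t} (Q : finPOrderType disp) (l : nat).
(** The right neighbour of column c is ordS c, cyclically; the entry at position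
    i of c has the entry at position i + dl c of ordS c to its right. *)
Variable dl : 'I_l -> nat.
Implicit Types (A : 'I_l -> seq Q) (c : 'I_l).

(** A violation of the row condition; a missing left entry also counts, since
    the columns of an array may have any lengths. *)
Definition flaw A c i : bool :=
  if onth (A (ordS c)) (i + dl c) is Some b then
    if onth (A c) i is Some a then (b < a)%O else true
  else false.

(** Twice the larger rank of the last entries b and z that stay in place when
    the tails are swapped at the flaw.  The summand 1 for z breaks ties: of two
    flaws that meet at a common entry, the one for which it plays the role of b
    has to come first. *)
Definition key A c i : nat :=
  maxn (oapp (fun b => (rank b).*2) 0 (onth (A (ordS c)) (i + dl c)))
       (if i is j.+1 then oapp (fun z => (rank z).*2.+1) 0 (onth (A c) j)
        else 0).

Definition sorted_cols A := forall c, sorted <%O (A c).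

Definition first_flaw A c i := flaw A c i /\ forall j, j < i -> ~~ flaw A c j.

Definition min_flaw A c i :=
  flaw A c i /\ forall c' j, flaw A c' j -> key A c i <= key A c' j.

(** The row i of column c is row i + dl c of the next column; the tail of column
    c starts in that row and the tail of the next column starts one row below.
    With this shift the two columns exchange their feet, and the flaw
    b < a becomes part of a chain. *)
Definition swap A c i : 'I_l -> seq Q := fun c' =>
  if c' == c then take i (A c) ++ drop (i + dl c).+1 (A (ordS c))
  else if c' == ordS c then take (i + dl c).+1 (A (ordS c)) ++ drop i (A c)
  else A c'.

Definition moved c i c' j :=
  (c' == c) && (i <= j) || (c' == ordS c) && (i + dl c < j).

Lemma flawP A c i : flaw A c i -> exists2 b,
  onth (A (ordS c)) (i + dl c) = Some b &
  forall a, onth (A c) i = Some a -> (b < a)%O.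
Proof.
rewrite /flaw; case eb: onth => [b|] //.
case ea: onth => [a|] h; exists b => //.
by move=> _ [<-].
Qed.

Lemma flawI A c i b : onth (A (ordS c)) (i + dl c) = Some b ->
  (forall a, onth (A c) i = Some a -> (b < a)%O) -> flaw A c i.
Proof. by move=> eb h; rewrite /flaw eb; case e: onth => [a|] //; apply: h. Qed.

Lemma first_flaw_ex A c i : flaw A c i -> exists2 j, j <= i & first_flaw A c j.
Proof.
move=> fi; have ex : exists j, flaw A c j by exists i.
case: (ex_minnP ex) => j fj jm; exists j; first exact: jm.
by split=> // k kj; apply: contraL kj => /jm; rewrite leqNgt.
Qed.

(** A missing entry of column c at position i - 1 would already be a flaw. *)
Lemma first_flaw_size A c i : first_flaw A c i -> i <= size (A c).
Proof.
case=> fi h; case: i fi h => // i fi h; have := h i (leqnn _).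
rewrite ltnNge; apply: contra => si; have [b eb _] := flawP fi.
have [b' eb'] : exists b', onth (A (ordS c)) (i + dl c) = Some b'.
  by apply: (onth_below _ eb); lia.
apply: (flawI eb') => a ea; have := onth_size ea.
by rewrite ltnNge si.
Qed.

Lemma flaw_size A c i : flaw A c i -> i + dl c < size (A (ordS c)).
Proof. by case/flawP=> b eb _; apply: onth_size eb. Qed.

Lemma key_b A c i b : onth (A (ordS c)) (i + dl c) = Some b ->
  (rank b).*2 <= key A c i.
Proof. by rewrite /key => ->; rewrite leq_maxl. Qed.

Lemma key_z A c i z : onth (A c) i = Some z -> (rank z).*2 < key A c i.+1.
Proof. by rewrite /key => -> /=; rewrite leq_maxr. Qed.

Section OneArray.
Hypothesis Q_free : three_plus_one_free Q.
Variable A : 'I_l -> seq Q.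
Hypothesis sA : sorted_cols A.

(** The tail of the next column may be attached to the head of column c.
    Let z be the last entry of that head and w < b < y the entries of the next
    column in the row of z, in the flawed row and in the row below it.  As there
    is no flaw in the row of z, not w < z, so that z < y by (3+1)-freeness. *)
Lemma first_flaw_cross c i j m x y : first_flaw A c i -> j < i ->
  onth (A c) j = Some x -> i + dl c < m -> onth (A (ordS c)) m = Some y ->
  (x < y)%O.
Proof.
case=> fi h ji ex im ey; case: i ji fi h im => // i ji fi h im.
have [b eb _] := flawP fi.
have [z ez] : exists z, onth (A c) i = Some z.
  by apply: onth_lt; apply: first_flaw_size.
have [w ew] : exists w, onth (A (ordS c)) (i + dl c) = Some w.
  by apply: (onth_below _ eb); lia.
apply: le_lt_trans (onth_sorted_le (sA c) _ ex ez) _ => //.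
have := h i (leqnn _); rewrite /flaw ew ez; apply: contraR => zy.
suff: (w < b)%O && (b < y)%O.
  case/andP=> wb yb; apply: contraT => wz.
  exact: (no_three_plus_one Q_free wb yb wz zy).
rewrite (onth_sorted_lt (sA _) _ ew eb) ?(onth_sorted_lt (sA _) _ eb ey) //.
Qed.

(** The doubling in [key] leaves room for the tie-breaking summand. *)
Lemma key_lt_above c i p : first_flaw A c i ->
    (forall b, onth (A (ordS c)) (i + dl c) = Some b -> (b < p)%O) ->
    (forall j z, j < i -> onth (A c) j = Some z -> (z < p)%O) ->
  key A c i < (rank p).*2.
Proof.
move=> [fi _] hb hz; have [b eb _] := flawP fi.
rewrite /key eb gtn_max /=; apply/andP; split.
  by have := rank_lt (hb _ eb); lia.
case: i fi hb eb hz => [|i] fi hb eb hz.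
  by have := rank_lt (hb _ eb); lia.
case ez: onth => [z|] /=; last by have := rank_lt (hb _ eb); lia.
by have := rank_lt (hz i z (leqnn _) ez); lia.
Qed.

Lemma key_lt_l c i m p : first_flaw A c i -> i <= m ->
  onth (A c) m = Some p -> key A c i < (rank p).*2.
Proof.
move=> fi im ep; apply: key_lt_above (fi) _ _ => [b eb|j z ji ez].
  have [a ea] : exists a, onth (A c) i = Some a.
    by apply: (onth_below _ ep); lia.
  apply: lt_le_trans (onth_sorted_le (sA c) im ea ep).
  have [b' eb' hb'] := flawP fi.1.
  by move: eb; rewrite eb' => -[<-]; apply: hb'.
by apply: (onth_sorted_lt (sA c) _ ez ep); lia.
Qed.

Lemma key_lt_r c i m p : first_flaw A c i -> i + dl c < m ->
  onth (A (ordS c)) m = Some p -> key A c i < (rank p).*2.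
Proof.
move=> fi im ep; apply: key_lt_above (fi) _ _ => [b eb|j z ji ez].
  exact: (onth_sorted_lt (sA _) _ eb ep).
exact: (first_flaw_cross fi ji ez im ep).
Qed.

Lemma key_first_flaw c i j : first_flaw A c i -> flaw A c j -> i < j ->
  key A c i < key A c j.
Proof.
move=> fi fj ij; have [b eb _] := flawP fj.
apply: leq_trans (key_lt_r fi _ eb) (key_b eb).
by rewrite ltn_add2r.
Qed.

Lemma min_flaw_first c i : min_flaw A c i -> first_flaw A c i.
Proof.
case=> fi h; have [j ji fj] := first_flaw_ex fi.
have := h _ _ fj.1; rewrite leqNgt; case: (ltngtP j i) ji => // [ji|<- //].
by rewrite key_first_flaw.
Qed.

End OneArray.

Section Swap.
Hypothesis Q_free : three_plus_one_free Q.
Variables (A : 'I_l -> seq Q) (c : 'I_l) (i : nat).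
Hypothesis sA : sorted_cols A.
Hypothesis cS : ordS c != c.
Hypothesis fA : first_flaw A c i.

Let B := swap A c i.
Let iA : i <= size (A c).
Proof. exact: first_flaw_size. Qed.
Let iSA : i + dl c < size (A (ordS c)).
Proof. exact: flaw_size fA.1. Qed.

Lemma onth_swap_l k : onth (B c) k =
  if k < i then onth (A c) k else onth (A (ordS c)) (k + dl c).+1.
Proof.
rewrite /B /swap eqxx onth_cat onth_take onth_drop size_takel //.
by case: ltnP => // ik; congr onth; lia.
Qed.

Lemma onth_swap_r k : onth (B (ordS c)) k =
  if k <= i + dl c then onth (A (ordS c)) k else onth (A c) (k - (dl c).+1).
Proof.
rewrite /B /swap (negbTE cS) eqxx onth_cat onth_take onth_drop size_takel //.
by rewrite ltnS; case: leqP => // ik; congr onth; lia.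
Qed.

Lemma onth_swap_fixed c' k : ~~ moved c i c' k -> onth (B c') k = onth (A c') k.
Proof.
rewrite /moved negb_or !negb_and -ltnNge -leqNgt.
have [->|cc'] := eqVneq c' c; first by rewrite onth_swap_l => /andP[/= ->].
have [->|Scc'] := eqVneq c' (ordS c); first by rewrite onth_swap_r => /= ->.
by rewrite /B /swap (negbTE cc') (negbTE Scc').
Qed.

(** All moved entries are greater than the two entries that define the key of
    the flaw, so that a flaw with a moved entry as its b or z has a larger
    key. *)
Lemma onth_swap_moved c' k p : moved c i c' k -> onth (B c') k = Some p ->
  key A c i < (rank p).*2.
Proof.
case/orP=> /andP[/eqP -> ik].
  rewrite onth_swap_l ltnNge ik; apply: key_lt_r => //.
  by rewrite ltnS leq_add2r.
by rewrite onth_swap_r leqNgt ik; apply: key_lt_l => //; lia.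
Qed.

Lemma key_swap : key B c i = key A c i.
Proof.
rewrite /key; congr maxn; first by rewrite onth_swap_r leqnn.
by case: (i) onth_swap_l => // j h; rewrite h ltnSn.
Qed.

Lemma sorted_swap : sorted_cols B.
Proof.
move=> c'; have [->|cc'] := eqVneq c' c.
  apply/sorted_onth => j k x y jk; rewrite !onth_swap_l.
  case: ltnP => [ji|ij]; case: ltnP => [ki|ik].
  - exact: onth_sorted_lt.
  - by move=> ex; apply: (first_flaw_cross Q_free sA fA ji ex); lia.
  - lia.
  - by apply: onth_sorted_lt => //; lia.
have [->|Scc'] := eqVneq c' (ordS c).
  apply/sorted_onth => j k x y jk; rewrite !onth_swap_r.
  case: leqP => [ji|ij]; case: leqP => [ki|ik].
  - exact: onth_sorted_lt.
  - move=> ex ey; have [b eb hb] := flawP fA.1.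
    apply: le_lt_trans (onth_sorted_le (sA _) ji ex eb) _.
    have [a ea] : exists a, onth (A c) i = Some a.
      by apply: (onth_below _ ey); lia.
    apply: lt_le_trans (hb _ ea) (onth_sorted_le (sA _) _ ea ey); lia.
  - lia.
  - by apply: onth_sorted_lt => //; lia.
by rewrite /B /swap (negbTE cc') (negbTE Scc').
Qed.

Lemma flaw_swap : flaw B c i.
Proof.
have [b eb _] := flawP fA.1.
apply: (@flawI _ _ _ b) => [|y]; first by rewrite onth_swap_r leqnn.
rewrite onth_swap_l ltnn; apply: (onth_sorted_lt _ _ eb) => //; exact: sA.
Qed.

Lemma swapK : swap B c i = A.
Proof.
apply/funext => c'; rewrite /swap.
have Bc : B c = take i (A c) ++ drop (i + dl c).+1 (A (ordS c)).
  by rewrite /B /swap eqxx.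
have BSc : B (ordS c) = take (i + dl c).+1 (A (ordS c)) ++ drop i (A c).
  by rewrite /B /swap (negbTE cS) eqxx.
have [->|cc'] := eqVneq c' c.
  rewrite Bc BSc take_size_cat ?size_takel // drop_size_cat ?size_takel //.
  exact: cat_take_drop.
have [->|Scc'] := eqVneq c' (ordS c).
  rewrite Bc BSc take_size_cat ?size_takel // drop_size_cat ?size_takel //.
  exact: cat_take_drop.
by rewrite /B /swap (negbTE cc') (negbTE Scc').
Qed.

(** By [onth_swap_moved] the entry b' of the flaw g at k has not moved.  If the
    position to its left has been affected, then either g is the flaw f where
    the swap was done, or g compares the columns ordS c and ordS (ordS c) and
    its entry z has moved or is the entry b of f.  A moved z would make the key too
    large.  Otherwise g is the flaw diagonally below f, and the tie-breaking in
    the keys implies rank b' <= rank z for the entry z of f.  It remains to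
    prove b' < y for the former left neighbour y of b'. *)
Lemma flaw_swap_low c' k : first_flaw B c' k -> key B c' k <= key A c i ->
  flaw A c' k /\ key A c' k = key B c' k.
Proof.
move=> fB kle; have [b' eb' hb'] := flawP fB.1.
have nmb : ~~ moved c i (ordS c') (k + dl c').
  apply/negP => mb; have := onth_swap_moved mb eb'.
  by rewrite ltnNge (leq_trans (key_b eb') kle).
have eAb := onth_swap_fixed nmb.
have same : ~~ moved c i c' k -> flaw A c' k /\ key A c' k = key B c' k.
  move=> nma; split; first by have := fB.1; rewrite /flaw -eAb -onth_swap_fixed.
  rewrite /key eAb; congr maxn; case: (k) nma => // j nma.
  rewrite onth_swap_fixed //; apply: contra nma; rewrite /moved.
  by case/orP=> /andP[-> h]; rewrite (leq_trans h) ?orbT // ltnW.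
have [ma|/same//] := boolP (moved c i c' k).
case/orP: (ma) => /andP[/eqP ec' ik]; subst c'.
  suff ki : k = i.
    by rewrite ki key_swap; split=> //; exact: fA.1.
  apply/eqP; rewrite eqn_leq ik andbT leqNgt; apply: contra nmb => ki.
  by rewrite /moved eqxx /= ltn_add2r ki orbT.
case: k ik fB kle eb' hb' nmb eAb same ma => // k.
rewrite ltnS => ik fB kle eb' hb' nmb eAb _ _.
have [zg ezg] : exists zg, onth (B (ordS c)) k = Some zg.
  by apply: onth_lt; apply: first_flaw_size.
have ki : k = i + dl c.
  apply/eqP; rewrite eqn_leq ik andbT leqNgt; apply/negP => ki.
  have mz : moved c i (ordS c) k by rewrite /moved eqxx ki orbT.
  have := onth_swap_moved mz ezg; rewrite ltnNge (leq_trans _ kle) //.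
  exact: ltnW (key_z ezg).
have zA : onth (A (ordS c)) k = Some zg by rewrite -ezg onth_swap_r ki leqnn.
split; last by rewrite /key eAb ezg zA.
apply: (@flawI _ _ _ b') => [|y ey]; first by rewrite -eAb.
apply: contraT => by'.
(* Suppose not b' < y.  As z < y, some w is greater than b' but not than z.  In
   the column of b', let t and x be the entries in the two rows preceding b';
   let q be the entry to the left of t.  As neither array has an earlier flaw
   here, not q < z and not t < q.  If x < z, then q is incomparable to the chain
   t < x < z; if not, then z is incomparable to the chain x < b' < w. *)
have kz := leq_trans (key_z ezg) kle; have kb := leq_trans (key_b eb') kle.
rewrite /key -ki zA /= in kz kb.
have [j [z [ij ez]]] : exists j z, i = j.+1 /\ onth (A c) j = Some z.
  case: (i) kz => [|j]; first by rewrite leq_max; lia.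
  case ez: onth => [z|] kz; first by exists j, z.
  by move: kz; rewrite leq_max /=; lia.
rewrite ij ez /= in kz kb.
have rbz : rank b' <= rank z by lia.
have zy : (z < y)%O.
  by apply: (first_flaw_cross Q_free sA fA _ ez _ ey); rewrite ?ij // ki ij.
have [w bw zw] := rank_witness rbz zy by'.
have eb'A : onth (A (ordS (ordS c))) (k.+1 + dl (ordS c)) = Some b'.
  by rewrite -eAb.
have fixed2 m x : m < k.+1 + dl (ordS c) ->
    onth (A (ordS (ordS c))) m = Some x -> onth (B (ordS (ordS c))) m = Some x.
  move=> mk <-; apply: onth_swap_fixed; apply: contra nmb.
  by rewrite /moved => /orP[]/andP[-> h]; rewrite ?(leq_trans h) ?orbT // ltnW.
have [x ex] : exists x, onth (A (ordS (ordS c))) (k + dl (ordS c)) = Some x.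
  by apply: (onth_below _ eb'A); lia.
have [t et] : exists t,
    onth (A (ordS (ordS c))) (j + dl c + dl (ordS c)) = Some t.
  by apply: (onth_below _ eb'A); lia.
have [q eq] : exists q, onth (A (ordS c)) (j + dl c) = Some q.
  by apply: (onth_below _ zA); lia.
have xb : (x < b')%O.
  by apply: (onth_sorted_lt (sA _) _ ex eb'A); rewrite ltn_add2r.
have tx : (t < x)%O.
  by apply: (onth_sorted_lt (sA _) _ et ex); rewrite ki ij !ltn_add2r.
have qz : ~~ (q < z)%O.
  have ji : j < i by rewrite ij.
  by have := fA.2 j ji; rewrite /flaw eq ez.
have tq : ~~ (t < q)%O.
  have jk : j + dl c < k.+1 by rewrite ki ij ltnS leq_add2r.
  have := fB.2 _ jk; rewrite /flaw (fixed2 _ _ _ et) ?ltn_add2r //.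
  rewrite onth_swap_r; have -> : j + dl c <= i + dl c by rewrite leq_add2r ij.
  by rewrite eq.
case: (boolP (x < z)%O) => [xz|xz].
  exact: (no_three_plus_one Q_free tx xz tq qz).
exact: (no_three_plus_one Q_free xb bw xz zw).
Qed.

End Swap.

(** [flaw_swap_low] without the assumption that the flaw is the first one
    between its columns: an earlier flaw would have a key smaller than the
    minimum. *)
Lemma key_swap_min A c i c' k : three_plus_one_free Q -> sorted_cols A ->
    ordS c != c -> min_flaw A c i -> flaw (swap A c i) c' k ->
    key (swap A c i) c' k <= key A c i ->
  flaw A c' k /\ key A c' k = key (swap A c i) c' k.
Proof.
move=> Q_free sA cS mA; have fA := min_flaw_first Q_free sA mA.
move=> fB kle; have [k' k'k fk'] := first_flaw_ex fB.
case: (ltngtP k' k) k'k => // [k'k|ek] _; last first.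
  by apply: flaw_swap_low => //; rewrite -ek.
have lt := key_first_flaw Q_free (sorted_swap Q_free sA cS fA) fk' fB k'k.
have [|f e] := flaw_swap_low Q_free sA cS fA fk'.
  exact: leq_trans (ltnW lt) kle.
by have := mA.2 _ _ f; rewrite e leqNgt (leq_trans lt kle).
Qed.

Lemma min_flaw_swap A c i : three_plus_one_free Q -> sorted_cols A ->
  ordS c != c -> min_flaw A c i -> min_flaw (swap A c i) c i.
Proof.
move=> Q_free sA cS mA; have fA := min_flaw_first Q_free sA mA.
split; first exact: flaw_swap.
move=> c' j fj; rewrite key_swap // leqNgt; apply/negP => lt.
have [f e] := key_swap_min Q_free sA cS mA fj (ltnW lt).
by have := mA.2 _ _ f; rewrite e leqNgt lt.
Qed.

(** The swap preserves the set of flaws of minimal key, so that any choice that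
    depends on this set only makes the swap an involution. *)
Lemma min_flaw_swapE A c i c' k : three_plus_one_free Q -> sorted_cols A ->
    ordS c != c -> min_flaw A c i ->
  min_flaw (swap A c i) c' k <-> min_flaw A c' k.
Proof.
move=> Q_free; move: A => A0.
have imp A : sorted_cols A -> ordS c != c -> min_flaw A c i ->
    min_flaw (swap A c i) c' k -> min_flaw A c' k.
  move=> sA cS mA [fB mB]; have fA := min_flaw_first Q_free sA mA.
  have le : key (swap A c i) c' k <= key A c i.
    by rewrite -(key_swap cS fA) mB // flaw_swap.
  have [f e] := key_swap_min Q_free sA cS mA fB le.
  by split=> // c'' j fj; rewrite e (leq_trans le) // mA.2.
move=> sA cS mA; split; first exact: imp.
have fA := min_flaw_first Q_free sA mA.
have mB := min_flaw_swap Q_free sA cS mA.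
have := imp _ (sorted_swap Q_free sA cS fA) cS mB.
by rewrite swapK.
Qed.

(** With a single column the two entries that a flaw compares belong to the same
    chain, in the correct order. *)
Lemma flaw_ordS A c i : sorted_cols A -> flaw A c i -> ordS c != c.
Proof.
move=> sA /flawP[b eb hb]; apply/eqP => e; rewrite e in eb.
have [a ea] := onth_below (leq_addr (dl c) i) eb.
have := onth_sorted_le (sA c) (leq_addr (dl c) i) ea eb.
by rewrite (lt_geF (hb _ ea)).
Qed.

Lemma big_swap (R : Type) (idx : R) (op : Monoid.com_law idx) (F : Q -> R)
    A c i :
  ordS c != c ->
  \big[op/idx]_c' \big[op/idx]_(p <- swap A c i c') F p =
  \big[op/idx]_c' \big[op/idx]_(p <- A c') F p.
Proof.
move=> cS; rewrite (bigD1 c) // [RHS](bigD1 c) //= (bigD1 (ordS c)) //.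
rewrite [in RHS](bigD1 (ordS c)) //= !Monoid.mulmA.
congr (op _ _); last first.
  by apply: eq_bigr => c' /andP[/negbTE n1 /negbTE n2]; rewrite /swap n1 n2.
have split_at n s : \big[op/idx]_(p <- s) F p =
    op (\big[op/idx]_(p <- take n s) F p) (\big[op/idx]_(p <- drop n s) F p).
  by rewrite -big_cat cat_take_drop.
rewrite /swap eqxx (negbTE cS) eqxx !big_cat /=.
rewrite (split_at i (A c)) (split_at (i + dl c).+1 (A (ordS c))).
rewrite Monoid.mulmACA [RHS]Monoid.mulmACA; congr (op _ _).
exact: Monoid.mulmC.
Qed.

Lemma min_flaw_ex A : (exists c i, flaw A c i) -> exists c i, min_flaw A c i.
Proof.
case=> c0 [i0 f0]; pose P n := `[< exists c i, flaw A c i /\ key A c i = n >].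
have ex : exists n, P n by exists (key A c0 i0); apply/asboolP; exists c0, i0.
case: (ex_minnP ex) => n /asboolP[c [i [f <-]]] h.
exists c, i; split=> // c' j f'.
by apply: h; apply/asboolP; exists c', j.
Qed.

End Flaws.

(** * The sign-reversing involution *)
Section Cancellation.
Context {disp : Order.disp_t} (Q : finPOrderType disp) (l M : nat).
Variable dl : 'I_l -> nat.
Hypothesis Q_free : three_plus_one_free Q.
Local Notation arr := {ffun 'I_l -> M.-bseq Q}.
Implicit Types T : arr.

Definition cols T : 'I_l -> seq Q := fun c => T c.

Definition chain_array T :=
  [forall c, sorted <%O (T c)] && (\sum_c size (T c) == M).

Definition flawed T := `[< exists c i, flaw dl (cols T) c i >].

Definition pick_flaw T := [pick f : 'I_l * 'I_M.+1 |
  `[< min_flaw dl (cols T) f.1 f.2 >]].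

Definition flip T : arr :=
  if pick_flaw T is Some f then
    [ffun c => insub_bseq M (swap dl (cols T) f.1 f.2 c)]
  else T.

Lemma chain_arrayP T : chain_array T -> sorted_cols (cols T).
Proof. by case/andP=> /forallP h _ c; apply: h. Qed.

Lemma flipP T : chain_array T -> flawed T -> exists f,
  [/\ pick_flaw T = Some f, min_flaw dl (cols T) f.1 f.2,
     cols (flip T) = swap dl (cols T) f.1 f.2 & ordS f.1 != f.1].
Proof.
move=> aT fT; have sT := chain_arrayP aT.
rewrite /flip /pick_flaw; case: pickP => [f /asboolP mf|no]; last first.
  move/asboolP: fT => /min_flaw_ex[c [i mf]].
  have := flaw_size mf.1; rewrite /cols => lt.
  have iM : i < M.+1.
    by have := size_bseq (T (ordS c)); move: lt; set s := size _; lia.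
  by have := no (c, Ordinal iM); move/asboolP; case.
have nS := flaw_ordS sT mf.1.
exists f; split=> //; apply/funext => c; rewrite /cols ffunE.
rewrite val_insubd ifT //; case/andP: aT => _ /eqP/eq_leq; apply: leq_trans.
under eq_bigr do rewrite -sum1_size.
rewrite -(big_swap dl _ (fun=> 1) (cols T) f.2 nS).
by rewrite (bigD1 c) //= sum1_size leq_addr.
Qed.

Lemma flip_chain T : chain_array T -> flawed T ->
  [/\ chain_array (flip T), flawed (flip T) & flip (flip T) = T].
Proof.
move=> aT fT; have sT := chain_arrayP aT.
have [f [pf mf eT nS]] := flipP aT fT.
have ff := min_flaw_first Q_free sT mf.
have sB := sorted_swap Q_free sT nS ff.
have aB : chain_array (flip T).
  apply/andP; split.
    by apply/forallP => c; have := sB c; rewrite -eT.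
  case/andP: aT => _ /eqP sT'; apply/eqP; rewrite -[RHS]sT'.
  transitivity (\sum_c \sum_(p <- cols (flip T) c) 1).
    by apply: eq_bigr => c _; rewrite sum1_size.
  by rewrite eT big_swap //; apply: eq_bigr => c _; rewrite sum1_size.
have fB : flawed (flip T).
  by apply/asboolP; exists f.1, f.2; rewrite eT; apply: flaw_swap.
split=> //; have [g [pg mg eB nSg]] := flipP aB fB.
have gf : g = f.
  apply: Some_inj; rewrite -pf -pg; apply: eq_pick => h /=.
  by apply/asbool_equiv_eq; rewrite eT; apply: min_flaw_swapE.
apply/ffunP => c; apply: val_inj.
by rewrite -[LHS]/(cols _ c) eB gf eT swapK.
Qed.

(** The sum equals its opposite by reindexing along [flip]. *)
Lemma sum_flawed_eq0 (F : arr -> int) :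
  (forall T c i, chain_array T -> first_flaw dl (cols T) c i -> ordS c != c ->
     forall T', cols T' = swap dl (cols T) c i -> F T' = (- F T)%R) ->
  (\sum_(T | chain_array T && flawed T) F T = 0)%R.
Proof.
move=> hF; set S := (\sum_(T | _) _)%R.
suff : S = (- S)%R by move=> h; lia.
rewrite /S -sumrN [LHS](reindex_onto flip flip).
  2: by move=> T /andP[aT fT]; case: (flip_chain aT fT).
apply: eq_big => [T|T /andP[/andP[aT fT] /eqP K]].
  apply/idP/idP => [/andP[/andP[aT fT] /eqP <-]|/andP[aT fT]].
    by have [-> ->] := flip_chain aT fT.
  by have [-> -> ->] := flip_chain aT fT; rewrite eqxx.
have [aT' fT' _] := flip_chain aT fT; rewrite K in aT' fT'.
have [f [_ mf eT nS]] := flipP aT' fT'.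
apply: hF eT => //; apply: (min_flaw_first Q_free _ mf).
exact: chain_arrayP.
Qed.

End Cancellation.

(** * The sign of a cyclic array *)
Lemma eqn_mod_cases a b N : a = b %[mod N] ->
  [\/ a = b, b + N <= a | a + N <= b].
Proof.
move=> e; have da := divn_eq a N; have db := divn_eq b N.
rewrite e in da; move: da db; set r := b %% N.
move: (a %/ N) (b %/ N) => x y -> ->.
case: (ltngtP x y) => [xy|yx|->]; [apply: Or33|apply: Or32|exact: Or31].
  by rewrite addnAC leq_add2r -mulSnr leq_mul2r xy orbT.
by rewrite addnAC leq_add2r -mulSnr leq_mul2r yx orbT.
Qed.

Section Sign.
(** Column c consists of the rows i with ms c < i <= ls c. *)
Variables (l d : nat) (ms ls : 'I_l -> nat).

(** Gluing a copy of column 0, shifted up by d, to the right of the last column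
    makes ordS c the right neighbour of c up to this row shift. *)
Definition wrap (c : 'I_l) := if c.+1 == l then d else 0.
Definition offset (c : 'I_l) := ms c + wrap c - ms (ordS c).
Definition height (c : 'I_l) := ls c - ms c.
Definition nboxes := \sum_c height c.

(** The position of the foot of a column along its diagonal, offset by l to
    remain in nat; adjacent swaps permute these feet modulo l + d. *)
Definition foot (n : 'I_l -> nat) (c : 'I_l) := ms c + n c + (l - c).

(** The Leibniz expansion of the determinant runs over the permutations w such
    that foot n c and foot height (w c) differ by a multiple of l + d.  When the
    lengths n have the correct sum, these multiples sum to 0, as in the usual
    Jacobi-Trudi determinants for cylindric shapes. *)
Definition residue_mx (n : 'I_l -> nat) : 'M[int]_l :=
  \matrix_(c, j) ((foot n c == foot height j %[mod l + d])%:R)%R.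

Definition sgn (n : 'I_l -> nat) : int :=
  if \sum_c n c == nboxes then (\det (residue_mx n))%R else 0%R.

Hypothesis ms_ls : forall c, ms c <= ls c.
Hypothesis ms_wrap : forall c, ms (ordS c) <= ms c + wrap c.
Hypothesis ls_wrap : forall c, ls (ordS c) <= ls c + wrap c.

Lemma val_ordS (c : 'I_l) : c.+1 != l -> ordS c = c.+1 :> nat.
Proof. by move=> cl; rewrite /= modn_small // ltn_neqAle cl ltn_ord. Qed.

Lemma val_ordS_last (c : 'I_l) : c.+1 = l -> ordS c = 0 :> nat.
Proof. by move=> /= ->; rewrite modnn. Qed.

(** Swapping the tails of two adjacent columns exchanges their feet modulo
    l + d, that is, two rows of the matrix. *)
Lemma sgn_swap n n' c : ordS c != c ->
    (forall c', c' != c -> c' != ordS c -> n' c' = n c') ->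
    n' c + (offset c).+1 = n (ordS c) -> n' (ordS c) = n c + (offset c).+1 ->
  sgn n' = (- sgn n)%R.
Proof.
move=> cS nE nc nS; rewrite /sgn.
have -> : \sum_c n' c = \sum_c n c.
  rewrite (bigD1 c) // [RHS](bigD1 c) //= (bigD1 (ordS c)) //.
  rewrite [in RHS](bigD1 (ordS c)) //= !addnA.
  congr (_ + _); first by rewrite nS -nc; lia.
  by apply: eq_bigr => c' /andP[? ?]; exact: nE.
case: ifP => _; last by rewrite oppr0.
suff -> : residue_mx n' = xrow c (ordS c) (residue_mx n).
  rewrite xrowE det_mulmx det_perm odd_tperm eq_sym cS expr1.
  by rewrite mulN1r.
have mw := ms_wrap c.
have fc : foot n' c = foot n (ordS c) %[mod l + d].
  rewrite /foot -nc; have := ltn_ord c; case: (eqVneq c.+1 l) => cl cl'.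
    rewrite val_ordS_last // -[LHS]modnDr; congr (_ %% _).
    by move: mw; rewrite /offset /wrap cl eqxx; lia.
  rewrite val_ordS //; congr (_ %% _).
  by move: mw; rewrite /offset /wrap (negbTE cl); lia.
have fS : foot n' (ordS c) = foot n c %[mod l + d].
  rewrite /foot nS; have := ltn_ord c; case: (eqVneq c.+1 l) => cl cl'.
    rewrite val_ordS_last // -[RHS]modnDr; congr (_ %% _).
    by move: mw; rewrite /offset /wrap cl eqxx; lia.
  rewrite val_ordS //; congr (_ %% _).
  by move: mw; rewrite /offset /wrap (negbTE cl); lia.
apply/matrixP => c' j; rewrite !mxE.
case: tpermP => [->|->|/eqP n1 /eqP n2]; rewrite ?fc ?fS //.
by rewrite /foot nE.
Qed.

Let E := foot height.

Lemma foot_height c : E c = ls c + (l - c).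
Proof. by rewrite /E /foot /height subnKC. Qed.

Lemma foot_height_anti (i j : 'I_l) : i < j -> E j < E i.
Proof.
have [k] := ubnP (j - i); elim: k i j => // k IH i j kij ij.
have il : i.+1 != l by have := ltn_ord j; lia.
have step : E (ordS i) < E i.
  have := ls_wrap i; rewrite !foot_height /wrap (negbTE il) val_ordS //.
  by have := ltn_ord j; lia.
case: (ltngtP i.+1 j) ij => // [ij _|ij _].
  by apply: leq_trans (ltnW step); apply: IH; rewrite val_ordS //; lia.
by rewrite (_ : j = ordS i) //; apply: ord_inj; rewrite val_ordS.
Qed.

Lemma foot_height_le (i j : 'I_l) : i <= j -> E j <= E i.
Proof.
rewrite leq_eqVlt => /predU1P[/ord_inj -> //|/foot_height_anti]; exact: ltnW.
Qed.

(** All feet of the shape lie in a window of length l + d, so that they are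
    pairwise incongruent. *)
Lemma foot_height_window (i j : 'I_l) : E i < E j + (l + d).
Proof.
have l0 : 0 < l by apply: leq_ltn_trans (ltn_ord i).
have ll : l.-1 < l by lia.
pose last := Ordinal ll; have ll1 : last.+1 = l by rewrite /= prednK.
have := foot_height_le (i := j) (j := last); have := ltn_ord j => jl.
have -> : j <= last by rewrite /=; lia.
have i0 : E i <= E (ordS last).
  by apply: foot_height_le; rewrite val_ordS_last.
have := ls_wrap last; rewrite /wrap ll1 eqxx.
move: i0; rewrite !foot_height val_ordS_last //= => i0 w /(_ isT); lia.
Qed.

Lemma foot_height_eq_mod (i j : 'I_l) :
  (E i == E j %[mod l + d]) = (i == j).
Proof.
apply/eqP/eqP => [/eqn_mod_cases[e|e|e]|->//].
- apply/ord_inj; case: (ltngtP i j) => // /foot_height_anti; lia.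
- by have := foot_height_window i j; lia.
- by have := foot_height_window j i; lia.
Qed.

Lemma sgn_height : sgn height = 1%R.
Proof.
rewrite /sgn eqxx (_ : residue_mx _ = 1%:M%R) ?det1 //.
by apply/matrixP => i j; rewrite !mxE foot_height_eq_mod.
Qed.

Lemma eq_sgn n n' : n =1 n' -> sgn n = sgn n'.
Proof. by move/funext ->. Qed.

Section Unflawed.
Variable n : 'I_l -> nat.
Hypothesis n_offset : forall c, n (ordS c) <= n c + offset c.
Hypothesis n_mod : forall c, exists j, foot n c = E j %[mod l + d].

(** No number congruent to a foot of the shape lies strictly between the feet of
    two neighbouring columns of the shape.  Hence a foot of n that is too low in
    column ordS c is at least as low as the foot of the shape in column c, and
    the foot of n in column c is lower still. *)
Lemma foot_above_step c : E (ordS c) < foot n (ordS c) -> E c < foot n c.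
Proof.
rewrite [in X in _ -> X]ltnNge => lt; apply/negP => le.
have no := n_offset c; have mw := ms_wrap c.
have [j /eqn_mod_cases jE] := n_mod (ordS c).
have w1 := foot_height_window j c; have w2 := foot_height_window j (ordS c).
have w3 := foot_height_window c j; have w4 := foot_height_window (ordS c) j.
have [cl|cl] := eqVneq c.+1 l.
  have up : foot n (ordS c) < foot n c + (l + d).
    by move: no mw; rewrite /foot /offset /wrap cl eqxx val_ordS_last //; lia.
  have j0 : E j <= E (ordS c) by apply: foot_height_le; rewrite val_ordS_last.
  have jc : E c <= E j by apply: foot_height_le; have := ltn_ord j; lia.
  by case: jE; lia.
have up : foot n (ordS c) < foot n c.
  move: no mw; rewrite /foot /offset /wrap (negbTE cl) val_ordS //.
  by have := ltn_ord c; lia.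
have [jc|cj] := leqP j c; first by have := foot_height_le jc; case: jE; lia.
have : E j <= E (ordS c) by apply: foot_height_le; rewrite val_ordS.
by case: jE; lia.
Qed.

(** Going around the cylinder, one foot that is too low makes all of them too
    low. *)
Lemma foot_above c c' : E c < foot n c -> E c' < foot n c'.
Proof.
have down (i j : 'I_l) : i <= j -> E j < foot n j -> E i < foot n i.
  have [k] := ubnP (j - i); elim: k i j => // k IH i j kij ij jE.
  case: (ltngtP i j) ij => // [ij _|/ord_inj -> //].
  have il : i.+1 != l by have := ltn_ord j; lia.
  by apply/foot_above_step/(IH _ j) => //; rewrite val_ordS //; lia.
move=> cE; have l0 : 0 < l by apply: leq_ltn_trans (ltn_ord c).
have ll : l.-1 < l by lia.
pose last := Ordinal ll; have ll1 : last.+1 = l by rewrite /= prednK.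
apply: (down _ last); first by rewrite /=; have := ltn_ord c'; lia.
by apply/foot_above_step/(down _ c) => //; rewrite val_ordS_last.
Qed.

(** Since the feet cannot all be too low when the total length is correct, none
    is too low, and then all of them agree with the shape. *)
Lemma unflawed_height : \sum_c n c = nboxes -> n =1 height.
Proof.
move=> sumE.
have le c : n c <= height c.
  rewrite leqNgt; apply/negP => lt.
  have {}lt : E c < foot n c by rewrite /E /foot; lia.
  have : nboxes < \sum_c n c.
    rewrite /nboxes (bigD1 c) //= [in X in _ < X](bigD1 c) //=.
    rewrite -addSn leq_add //; first by move: lt; rewrite /E /foot; lia.
    by apply: leq_sum => c' _; have := foot_above c' lt; rewrite /E /foot; lia.
  by rewrite sumE ltnn.
have := leqif_sum (P := xpredT) (fun c _ => leqif_eq (le c)).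
case=> _; rewrite sumE /nboxes eqxx => /esym/forallP h c.
by have /eqP := h c.
Qed.

End Unflawed.

Lemma sgn_unflawed n : (forall c, n (ordS c) <= n c + offset c) ->
  sgn n = if [forall c, n c == height c] then 1%R else 0%R.
Proof.
move=> no; case: ifP => [/forallP h|/negbT hn].
  by rewrite -sgn_height; apply: eq_sgn => c; apply/eqP.
rewrite /sgn; case: eqP => // sumE; apply/eqP; apply: contraR hn => dn0.
suff h : n =1 height by apply/forallP => c; rewrite h.
apply: unflawed_height => // c; apply: contrapT => no_j; case/eqP: dn0.
rewrite (expand_det_row _ c) big1 // => j _; rewrite mxE.
by case: eqP => [e|]; [case: no_j; exists j | rewrite mul0r].
Qed.

End Sign.

(** * Signed sums of products of elementary functions *)
Definition content (I : choiceType) (s : seq I) : {cmonom I} :=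
  \big[mmul/mone]_(p <- s) ucm p.

Lemma malg_prodU (I : choiceType) (J : Type) (r : seq J) (P : pred J)
    (F : J -> {cmonom I}) :
  (\prod_(i <- r | P i) (<< F i >> : {malg int[{cmonom I}]}) =
    << \big[mmul/mone]_(i <- r | P i) F i >>)%R.
Proof.
rewrite (big_morph (fun k => << k >>%R : {malg int[{cmonom I}]}) (id1 := 1%R)
  (op1 := *%R)) //; first by move=> x y; rewrite malgM_def fgmulUU mulr1.
Qed.

Lemma esfP_sorted (disp : Order.disp_t) (Q : finPOrderType disp) k :
  (esfP Q k = \sum_(t : k.-tuple Q | sorted <%O t) << content t >>)%R.
Proof. by apply: eq_bigr => t _; rewrite malg_prodU. Qed.

(** Sequences of bounded size form a single finite type for all k <= M. *)
Lemma esfP_bseq (disp : Order.disp_t) (Q : finPOrderType disp) M k : k <= M ->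
  (esfP Q k = \sum_(s : M.-bseq Q | sorted <%O s && (size s == k))
     << content s >>)%R.
Proof.
move=> kM; rewrite esfP_sorted.
pose h (t : k.-tuple Q) : M.-bseq Q := widen_bseq kM (bseq_of_tuple t).
transitivity (\sum_(s in h @: [set t : k.-tuple Q | sorted <%O t])
    (<< content s >> : {malg int[{cmonom Q}]}))%R.
  rewrite big_imset; first by apply: eq_bigl => t; rewrite inE.
  by move=> t u _ _ /(congr1 val) /= /val_inj.
apply: eq_bigl => s; apply/imsetP/andP => [[t]|[ss /eqP sk]].
  by rewrite inE => st -> /=; rewrite size_tuple.
have sk' : size s == k by rewrite sk.
by exists (Tuple sk'); rewrite ?inE //; apply: val_inj.
Qed.

Section JacobiTrudi.
Variables (l d : nat) (ms ls : 'I_l -> nat).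
Let M := nboxes ms ls.

Definition jacobi_trudi (R : comNzRingType) (h : nat -> R) : R :=
  (\sum_(n : {ffun 'I_l -> 'I_M.+1}) (\prod_c h (n c)) *~ 
     sgn d ms ls (fun c => n c))%R.

Lemma rmorph_jacobi_trudi (R S : comNzRingType) (f : {rmorphism R -> S})
    (h : nat -> R) :
  f (jacobi_trudi h) = jacobi_trudi (f \o h).
Proof.
rewrite rmorph_sum; apply: eq_bigr => n _.
by rewrite rmorphMz rmorph_prod.
Qed.

Section Arrays.
Context {disp : Order.disp_t} (Q : finPOrderType disp).
Local Notation arr := {ffun 'I_l -> M.-bseq Q}.

Definition content_array (T : arr) : {cmonom Q} :=
  \big[mmul/mone]_c content (T c).

Lemma jacobi_trudi_arrays m :
  ((jacobi_trudi (esfP Q))@_m = \sum_(T : arr | chain_array T)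
     (content_array T == m)%:R * sgn d ms ls (fun c => size (T c)))%R.
Proof.
transitivity (\sum_(T : arr | [forall c, sorted <%O (T c)])
     (content_array T == m)%:R * sgn d ms ls (fun c => size (T c)))%R; last first.
  rewrite (bigID (fun T : arr => \sum_c size (T c) == M)) /=.
  rewrite [X in (_ + X)%R]big1 ?addr0 // => T /andP[_ /negbTE h].
  by rewrite /sgn h mulr0.
pose sizes (T : arr) : {ffun 'I_l -> 'I_M.+1} := [ffun c => inord (size (T c))].
have sizesE T c : sizes T c = size (T c) :> nat.
  by rewrite ffunE inordK // ltnS size_bseq.
rewrite (partition_big sizes xpredT) //= raddf_sum; apply: eq_bigr => n _.
under eq_bigr => c _ do rewrite (esfP_bseq Q (leq_ord (n c))).
rewrite bigA_distr_big_dep /= raddfMz raddf_sum /= -mulrzr mulr_suml.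
apply: eq_big => [T|T].
  apply/familyP/andP => [h|[/forallP h /eqP e] c].
    split; first by apply/forallP => c; case/andP: (h c).
    apply/eqP/ffunP => c; apply: ord_inj; rewrite sizesE.
    by case/andP: (h c) => _ /eqP.
  by rewrite -topredE /= h -e sizesE eqxx.
move=> /familyP h; rewrite malg_prodU mcoeffU1 intz; congr (_ * _)%R.
by apply: eq_sgn => c; case/andP: (h c) => _ /eqP ->.
Qed.

Hypothesis Q_free : three_plus_one_free Q.
Hypothesis ms_ls : forall c, ms c <= ls c.
Hypothesis ms_wrap : forall c, ms (ordS c) <= ms c + wrap d c.
Hypothesis ls_wrap : forall c, ls (ordS c) <= ls c + wrap d c.

Definition cyl_array (T : arr) :=
  [&& [forall c, sorted <%O (T c)], [forall c, size (T c) == height ms ls c] &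
   ~~ flawed (offset d ms) T].

Lemma unflawed_size (T : arr) : ~~ flawed (offset d ms) T ->
  forall c, size (T (ordS c)) <= size (T c) + offset d ms c.
Proof.
move=> nf c; rewrite leqNgt; apply: contra nf => lt.
apply/asboolP; exists c, (size (T c)).
have [b eb] := onth_lt lt.
by apply: (flawI eb) => a ea; have := onth_size ea; rewrite /cols ltnn.
Qed.

(** Flawed arrays cancel, and among the others only those of the correct shape
    have a nonzero sign, which is then 1. *)
Lemma jacobi_trudi_cyl_array m :
  ((jacobi_trudi (esfP Q))@_m =
     (#|[pred T | cyl_array T && (content_array T == m)]|)%:Z)%R.
Proof.
rewrite jacobi_trudi_arrays.
rewrite (bigID (flawed (offset d ms))) /= sum_flawed_eq0 ?add0r //; last first.
  move=> T c i aT fT cS T' eT'.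
  have eC : content_array T' = content_array T.
    have := big_swap (offset d ms) _ (@ucm Q) (cols T) i cS.
    by rewrite -eT'; apply.
  rewrite eC -mulrN; congr (_ * _)%R.
  have iT := first_flaw_size fT; have iS := flaw_size fT.1.
  rewrite -(@sgn_swap _ _ _ _ ms_wrap _ (fun c => size (T' c)) c) //.
  - move=> c' n1 n2; rewrite -/(cols T' c') eT' /swap.
    by rewrite (negbTE n1) (negbTE n2).
  - rewrite -/(cols T' c) eT' /swap eqxx size_cat size_takel // size_drop.
    by move: iS; rewrite /cols; lia.
  - rewrite -/(cols T' (ordS c)) eT' /swap (negbTE cS) eqxx size_cat.
    by rewrite size_takel // size_drop; move: iT; rewrite /cols; lia.
rewrite -[RHS]natz -sum1_card natr_sum /= big_mkcond [RHS]big_mkcond /=.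
apply: eq_bigr => T _; rewrite !inE /cyl_array /chain_array.
case: (boolP (flawed _ _)) => fT; first by rewrite !andbF.
rewrite !andbT; case: forallP => //= sT.
rewrite sgn_unflawed //; last exact: unflawed_size.
case: (boolP [forall c, _]) => /= [/forallP h|_]; last by rewrite mulr0 if_same.
rewrite mulr1 (_ : _ == M); first by case: eqP.
by apply/eqP/eq_bigr => c _; apply/eqP.
Qed.

End Arrays.
End JacobiTrudi.

(** * Cylindric tableaux as arrays of chains *)
Lemma nth_count_leq (s : seq nat) i j : sorted geq s -> 0 < j ->
  (j <= nth 0 s i) = (i < count (leq j) s).
Proof.
move=> ss j0; elim: s ss i => [|x s IH] ss i;
  first by rewrite nth_nil leqNgt j0.
have {}IH := IH (path_sorted ss).
have [jx|xj] := leqP j x; first by case: i => [|i]; rewrite /= jx //= IH.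
have c0 : count (leq j) s = 0.
  apply/eqP; rewrite -leqn0 leqNgt -has_count; apply/hasPn => y ys.
  have := order_path_min (rev_trans leq_trans) ss => /allP/(_ y ys) yx.
  by rewrite -ltnNge (leq_ltn_trans yx xj).
rewrite /= c0 (leqNgt j x) xj; case: i => [|i] /=; first by rewrite leqNgt xj.
by rewrite IH c0.
Qed.

Lemma mem_diagram la i j : ((i, j) \in diagram la) =
  [&& 0 < j, 0 < i & i <= cpart la j].
Proof.
have /andP[ss _] := partsP la.
rewrite /diagram !inE /=; apply/allpairsPdep/and3P => /=.
  case=> i' [j' []]; rewrite !mem_iota !add1n.
  move=> /andP[i0 _] /andP[j0 jl] [-> ->].
  by split=> //; case: i' i0 jl => // i' _; rewrite ltnS /part /= nth_count_leq.
case=> j0 i0 ij; exists i, j; split=> //; rewrite mem_iota add1n ltnS.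
  by rewrite i0 (leq_trans ij) // count_size.
by rewrite j0; case: i i0 ij => // i _; rewrite -nth_count_leq.
Qed.

Section Shape.
Variables (la mu : intpart) (d : nat).
Hypothesis shape : cylindric_shape la mu d.
Let l := part la 1.

Definition col_start (c : 'I_l) := cpart mu c.+1.
Definition col_end (c : 'I_l) := cpart la c.+1.

Lemma mem_skew i j : 0 < j ->
  ((i, j) \in Defs.skew la mu) = (cpart mu j < i <= cpart la j).
Proof.
move=> j0; rewrite in_fsetD !mem_diagram j0.
by case: i => //= i; rewrite -ltnNge.
Qed.

Lemma skew_col i j : (i, j) \in Defs.skew la mu -> exists c : 'I_l, j = c.+1.
Proof.
rewrite in_fsetD => /andP[_]; rewrite mem_diagram.
case: j => //= j /andP[i0 ij].
suff jl : j < l by exists (Ordinal jl).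
have /andP[ss _] := partsP la.
by rewrite /l /part nth_count_leq //; apply: leq_trans ij.
Qed.

Lemma col_start_end c : col_start c <= col_end c.
Proof.
case: shape => /fsubsetP sub _ _ _; rewrite /col_start /col_end.
case E: (cpart mu c.+1) => [//|n].
have : (n.+1, c.+1) \in diagram mu by rewrite mem_diagram E /=.
by move/sub; rewrite mem_diagram.
Qed.

Lemma cpart_anti (nu : intpart) j : cpart nu j.+1 <= cpart nu j.
Proof. by apply: sub_count => x /=; apply: ltnW. Qed.

Lemma cpart_wrap (nu : intpart) (c : 'I_l) :
    cpart nu 1 - cpart nu l <= d ->
  cpart nu (ordS c).+1 <= cpart nu c.+1 + wrap d c.
Proof.
rewrite /wrap => nud; have [cl|cl] := eqVneq c.+1 l.
  by rewrite val_ordS_last // cl; move: nud; lia.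
by rewrite val_ordS // addn0 cpart_anti.
Qed.

Lemma col_start_wrap c : col_start (ordS c) <= col_start c + wrap d c.
Proof. by case: shape => _ _ h _; apply: cpart_wrap. Qed.

Lemma col_end_wrap c : col_end (ordS c) <= col_end c + wrap d c.
Proof. by case: shape => _ h _ _; apply: cpart_wrap. Qed.

Let M := nboxes col_start col_end.

Section Tableaux.
Context {disp : Order.disp_t} (Q : finPOrderType disp).
Local Notation arr := {ffun 'I_l -> M.-bseq Q}.
Implicit Types (T : {ffun Defs.skew la mu -> Q}) (c : 'I_l).

Lemma fillE T (b : Defs.skew la mu) : fill T (val b).1 (val b).2 = Some (T b).
Proof.
rewrite /fill; have -> : ((val b).1, (val b).2) = val b by case: (val b).
by rewrite valK.
Qed.

Lemma fill_mem T i j : fill T i j = ((i, j) \in Defs.skew la mu) :> bool.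
Proof. by rewrite /fill; case: insubP => [u ->|/negbTE ->]. Qed.

Lemma fill_skew T i j x : fill T i j = Some x -> (i, j) \in Defs.skew la mu.
Proof. by rewrite -(fill_mem T) => ->. Qed.

Definition tab_col T c : seq Q :=
  pmap (fun i => fill T (col_start c + i).+1 c.+1)
    (iota 0 (height col_start col_end c)).

Lemma fill_col_mem T c i :
  fill T (col_start c + i).+1 c.+1 = (i < height col_start col_end c) :> bool.
Proof.
rewrite fill_mem mem_skew // ltnS leq_addr /=.
by rewrite -ltn_subRL.
Qed.

Lemma size_tab_col T c : size (tab_col T c) = height col_start col_end c.
Proof.
rewrite size_pmap -[RHS](size_iota 0); apply/eqP; rewrite -all_count.
by apply/allP => i; rewrite mem_iota => ih; rewrite /= fill_col_mem.
Qed.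

Lemma onth_pmap_iota (T : Type) (f : nat -> option T) k n i :
    (forall j, j < n -> f (k + j) : bool) ->
  onth (pmap f (iota k n)) i = if i < n then f (k + i) else None.
Proof.
elim: n k i => [|n IH] k i h /=; first by rewrite onth0n.
have := h 0 isT; rewrite addn0; case ek: (f k) => [x|] // _ /=.
case: i => [|i] /=; first by rewrite addn0 ek.
by rewrite IH ?addSnnS // => j jn; rewrite addSnnS; apply: h.
Qed.

Lemma onth_tab_col T c i :
  onth (tab_col T c) i = fill T (col_start c + i).+1 c.+1.
Proof.
rewrite onth_pmap_iota => [|j jn]; last by rewrite fill_col_mem.
by have := fill_col_mem T c i; case: fill => [x|] <-.
Qed.

Definition tab_array T : arr := [ffun c => insub_bseq M (tab_col T c)].

Lemma tab_arrayE T : cols (tab_array T) = tab_col T.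
Proof.
apply/funext => c; rewrite /cols ffunE val_insubd ifT // size_tab_col.
by rewrite /M /nboxes (bigD1 c) //= leq_addr.
Qed.

Lemma content_tab_array T : content_array (tab_array T) = monom_of T.
Proof.
pose G (b : nat * nat) : {cmonom Q} := oapp (@ucm Q) mone (fill T b.1 b.2).
transitivity (\big[mmul/mone]_(b : Defs.skew la mu) G (val b)); last first.
  by apply: eq_bigr => b _; rewrite /G fillE.
rewrite -(big_seq_fsetE _ _ xpredT G) /=.
pose r := [seq ((col_start c + i).+1, (c : nat).+1) |
  c <- enum 'I_l, i <- iota 0 (height col_start col_end c)].
rewrite [RHS](perm_big r) /=; last first.
  apply: uniq_perm; first exact: fset_uniq.
    apply: allpairs_uniq_dep; first exact: enum_uniq.
      by move=> c _; apply: iota_uniq.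
    move=> [c i] [c' i'] _ _ /= [e /ord_inj ec]; subst c'; congr Tagged; lia.
  move=> [i j]; apply/idP/allpairsPdep => /= [ij|].
    have [c ec] := skew_col ij; subst j; exists c, (i - (col_start c).+1).
    move: ij; rewrite mem_skew // mem_enum mem_iota /height /col_start /col_end.
    by move=> h; split=> //; [lia | congr pair; lia].
  case=> c [k [_ ]]; rewrite mem_iota add0n => /= kh [-> ->].
  rewrite mem_skew // ltnS leq_addr /=; move: kh; rewrite /height.
  by rewrite /col_start /col_end; lia.
rewrite big_allpairs_dep big_enum /=; apply: eq_bigr => c _.
rewrite -/(cols (tab_array T) c) tab_arrayE /content /tab_col.
elim: (iota _ _) => [|i s IH]; first by rewrite !big_nil.
rewrite big_cons /= -IH /G /=.
by case: fill => [x|] /=; rewrite ?big_cons ?mul1m.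
Qed.

Lemma tab_array_inj : injective tab_array.
Proof.
move=> T T' e; apply/ffunP => b; apply: Some_inj; rewrite -!fillE.
have : ((val b).1, (val b).2) \in Defs.skew la mu by case: (val b) (valP b).
case: (val b) => i j /= ij; have [c ec] := skew_col ij; subst j.
move: ij; rewrite mem_skew // => /andP[ci _].
have ei : i = (col_start c + (i - (col_start c).+1)).+1.
  by rewrite /col_start; lia.
by rewrite ei -!onth_tab_col -!tab_arrayE e.
Qed.

Lemma tab_flaw T c i : flaw (offset d col_start) (tab_col T) c i ->
  exists a b, [/\ fill T (col_start c + i).+1 c.+1 = Some a,
    fill T (col_start c + i + wrap d c).+1 (ordS c).+1 = Some b & (b < a)%O].
Proof.
case/flawP=> b; rewrite !onth_tab_col => eb hb.
have e : col_start (ordS c) + (i + offset d col_start c) =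
    col_start c + i + wrap d c.
  by have := col_start_wrap c; rewrite /offset; lia.
rewrite e in eb; case ea: fill hb => [a|] hb; first by exists a, b; rewrite hb.
have := fill_col_mem T c i; rewrite ea => /esym/negbT.
rewrite -leqNgt; have := fill_skew eb; rewrite mem_skew //.
have := col_end_wrap c; have := col_start_end c.
by rewrite /height /col_end; lia.
Qed.

(** The row condition of the glued filling compares column c with column ordS c,
    shifted by d rows exactly when c is the last column. *)
Lemma cyl_tableauP T : is_cyl_tableau d T <->
  sorted_cols (tab_col T) /\
  forall c i, ~~ flaw (offset d col_start) (tab_col T) c i.
Proof.
split=> [[ver hor]|[sT nf]].
  split=> [c|c i].
    apply: sorted_onthS => i x y; rewrite !onth_tab_col addnS => ex ey.
    apply: (ver (d + (col_start c + i).+1) c.+1); rewrite /glue ltn_ord.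
      by rewrite addKn.
    by rewrite -addnS addKn.
  apply/negP => /tab_flaw[a [b [ea eb ba]]].
  suff /negP : ~~ (b < a)%O by apply.
  apply: (hor (d + (col_start c + i).+1) c.+1).
    by rewrite /glue ltn_ord addKn.
  move: eb; rewrite /glue /wrap; have [cl|cl] := eqVneq c.+1 l.
    rewrite val_ordS_last // cl ltnn eqxx => <-.
    by congr fill; lia.
  rewrite val_ordS // addn0 addKn ifT //.
  by rewrite ltn_neqAle cl ltn_ord.
have ver i j x y : fill T i j = Some x -> fill T i.+1 j = Some y -> (x < y)%O.
  move=> ex ey; have ij := fill_skew ex; have [c ec] := skew_col ij; subst j.
  move: ij; rewrite mem_skew // => /andP[ci _].
  have [k ei] : exists k, i = (col_start c + k).+1.
    by exists (i - (col_start c).+1); rewrite /col_start; lia.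
  move: ex ey; rewrite ei -onth_tab_col -[(_ + k).+1]addnS -onth_tab_col.
  exact: onth_sorted_lt (sT c) (leqnn _).
have hor c i a b : fill T i c.+1 = Some a ->
    fill T (i + wrap d c) (ordS c).+1 = Some b -> ~~ (b < a)%O.
  move=> ea eb; have := fill_skew ea; rewrite mem_skew // => /andP[ci _].
  have ei : i = (col_start c + (i - (col_start c).+1)).+1.
    by rewrite /col_start; lia.
  have := nf c (i - (col_start c).+1); apply: contra => ba.
  apply: (@flawI _ _ _ _ _ _ _ b).
    rewrite onth_tab_col -eb; congr fill; have := col_start_wrap c.
    by rewrite /offset; lia.
  by rewrite onth_tab_col -ei ea => _ [<-].
split=> r c x y; rewrite /glue -/l.
  case: (leqP c l) => cl.
    have [dr|rd] := leqP d r; first by rewrite subSn //; apply: ver.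
    rewrite (_ : r - d = 0) => [/fill_skew|]; last by lia.
    by have [->|c0] := posnP c; rewrite in_fsetD !mem_diagram /= ?andbF.
  by case: eqP => // _; apply: ver.
case: (leqP c l) => cl; last first.
  by rewrite [c < l]ltnNge (ltnW cl) eqSS (gtn_eqF cl).
move=> ex; have [e ec] := skew_col (fill_skew ex); subst c.
have [el|el] := eqVneq e.+1 l.
  rewrite el ltnn eqxx => ey; apply: (hor e (r - d)); rewrite ?ex //.
  rewrite /wrap el eqxx val_ordS_last //; rewrite -ey; congr fill.
  have := fill_skew ex; rewrite mem_skew //; lia.
rewrite ifT; last by rewrite ltn_neqAle el ltn_ord.
move=> ey; apply: (hor e (r - d)); rewrite ?ex //.
by rewrite /wrap (negbTE el) val_ordS // addn0.
Qed.

Lemma tab_array_surj (A : arr) : cyl_array d A -> exists T, A = tab_array T.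
Proof.
case/and3P=> _ /forallP sA _.
have ex (b : Defs.skew la mu) : exists p, exists2 c : 'I_l, (val b).2 = c.+1 &
    onth (A c) ((val b).1 - (col_start c).+1) = Some p.
  have bs : ((val b).1, (val b).2) \in Defs.skew la mu by case: (val b) (valP b).
  have [c ec] := skew_col bs.
  have [|p ep] := @onth_lt _ (A c) ((val b).1 - (col_start c).+1).
    move: bs; rewrite ec mem_skew // (eqP (sA c)) /height /col_start /col_end.
    by lia.
  by exists p, c.
have [f fE] := choice ex; exists [ffun b => f b].
apply/ffunP => c; apply: val_inj; apply: eq_from_onth => i.
rewrite -![val _]/(cols _ c) tab_arrayE onth_tab_col /cols.
have := fill_col_mem [ffun b => f b] c i.
case: (ltnP i (height col_start col_end c)) => ih; last first.
  by case: fill => // _; rewrite onth_default // (eqP (sA c)).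
rewrite /fill; case: insubP => //= b bs bE _; rewrite ffunE.
have {}bE : fsval b = ((col_start c + i).+1, (c : nat).+1) := bE.
have [c' ec'] := fE b; rewrite /= bE /= in ec' *.
have -> : c' = c by apply: ord_inj; case: ec'.
by rewrite subSS addKn.
Qed.

Lemma cyl_array_tab T : cyl_array d (tab_array T) <-> is_cyl_tableau d T.
Proof.
have e := tab_arrayE T; split=> [/and3P[/forallP sT _ nf]|].
  apply/cyl_tableauP; rewrite -e; split=> [c|c i]; first exact: sT.
  by apply: contra nf => f; apply/asboolP; exists c, i.
move/cyl_tableauP; rewrite -e => -[sT nf]; apply/and3P; split.
- by apply/forallP => c; apply: sT.
- by apply/forallP => c; rewrite -/(cols _ c) e size_tab_col.
- by apply/asboolP => -[c [i f]]; have := nf c i; rewrite f.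
Qed.

Lemma jacobi_trudi_tableaux m : three_plus_one_free Q ->
  ((jacobi_trudi d col_start col_end (esfP Q))@_m =
     (#|[pred T : {ffun Defs.skew la mu -> Q} |
          `[< is_cyl_tableau d T >] && (monom_of T == m)]|)%:Z)%R.
Proof.
move=> Q_free; rewrite jacobi_trudi_cyl_array //;
  [|exact: col_start_end|exact: col_start_wrap|exact: col_end_wrap].
congr Posz; rewrite -[RHS](card_imset _ tab_array_inj); apply: eq_card => A.
apply/idP/imsetP => [/andP[cA /eqP mA]|[T]].
  have [T eT] := tab_array_surj cA; exists T => //; rewrite inE; apply/andP.
  rewrite -content_tab_array -eT mA eqxx; split=> //.
  by apply/asboolP/cyl_array_tab; rewrite -eT.
rewrite inE => /andP[/asboolP/cyl_array_tab cT /eqP mT] ->.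
by rewrite inE; apply/andP; rewrite cT content_tab_array mT eqxx.
Qed.

End Tableaux.
End Shape.

(** * Products of elementary functions and families of sets *)
Lemma cm_prod (I : choiceType) (J : Type) (r : seq J) (P : pred J)
    (F : J -> {cmonom I}) i :
  (\big[mmul/mone]_(j <- r | P j) F j) i = \sum_(j <- r | P j) F j i.
Proof.
by rewrite (big_morph (fun m : {cmonom I} => m i) (id1 := 0) (op1 := addn))
  // => [x y|]; rewrite ?cmM ?cm1.
Qed.

Lemma contentE (I : choiceType) (s : seq I) i : content s i = count_mem i s.
Proof.
rewrite /content cm_prod; elim: s => [|x s IH]; first by rewrite big_nil.
by rewrite big_cons IH cmU.
Qed.

Lemma monom_ofE (I : finType) (V : choiceType) (f : I -> V) v :
  monom_of f v = #|[pred i | f i == v]|.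
Proof.
rewrite /monom_of cm_prod -sum1_card [RHS]big_mkcond.
by apply: eq_bigr => i _; rewrite cmU inE; case: eqP.
Qed.

Definition mset (I : finType) (S : {set I}) : {cmonom I} :=
  \big[mmul/mone]_(i in S) ucm i.

Lemma msetE (I : finType) (S : {set I}) i : mset S i = (i \in S).
Proof.
rewrite /mset cm_prod; have [iS|iS] := boolP (i \in S).
  rewrite (bigD1 i) //= cmUU big1 ?addn0 // => j /andP[_ /negbTE ji].
  by rewrite cmU ji.
by rewrite big1 // => j jS; rewrite cmU; case: eqP iS => // <-; rewrite jS.
Qed.

Section ChainSets.
Context {disp : Order.disp_t} (Q : finPOrderType disp).

Definition chain_set (S : {set Q}) : bool :=
  [forall p in S, forall q in S, (p >=< q)%O].

Lemma esfP_chain_sets k :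
  (esfP Q k = \sum_(S : {set Q} | chain_set S && (#|S| == k)) << mset S >>)%R.
Proof.
rewrite esfP_sorted.
pose h (t : k.-tuple Q) : {set Q} := [set p in t].
transitivity (\sum_(S in h @: [set t : k.-tuple Q | sorted <%O t])
    (<< mset S >> : {malg int[{cmonom Q}]}))%R.
  rewrite big_imset => [|t u]; last first.
    rewrite !inE => st su e; apply: val_inj.
    apply: (irr_sorted_eq lt_trans ltxx st su) => p.
    by have /setP/(_ p) := e; rewrite !inE.
  apply: eq_big => [t|t st]; first by rewrite inE.
  congr (<< _ >>)%R; apply/eqP/cmP => p; rewrite msetE inE contentE.
  by rewrite count_uniq_mem // (sorted_uniq lt_trans ltxx).
apply: eq_bigl => S; apply/imsetP/andP => [[t]|[cS /eqP Sk]].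
  rewrite inE => st ->; have ut := sorted_uniq lt_trans ltxx st; split.
    apply/forall_inP => p; rewrite inE => pt; apply/forall_inP => q.
    rewrite inE => qt; have /sorted_onth h' := st.
    have /onthP[i ei] := pt; have /onthP[j ej] := qt.
    case: (ltngtP i j) => ij.
    - exact/lt_comparable/(h' _ _ _ _ ij ei ej).
    - by rewrite comparable_sym; apply/lt_comparable/(h' _ _ _ _ ij ej ei).
    - by move: ej; rewrite -ij ei => -[->]; exact: comparablexx.
  by rewrite cardsE (card_uniqP ut) size_tuple.
have sz : size (sort <=%O (enum S)) == k by rewrite size_sort -cardE Sk.
exists (Tuple sz); last by apply/setP => p; rewrite !inE mem_sort mem_enum.
rewrite inE /= lt_sorted_uniq_le sort_uniq enum_uniq /=.
apply: (@sort_sorted_in _ [in S] <=%O); last by apply/allP => p; rewrite mem_enum.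
by move=> p q pS qS; have /forall_inP/(_ p pS)/forall_inP/(_ q qS) := cS.
Qed.

Definition chain_family (I : finType) (n : I -> nat) (m : {cmonom Q}) :=
  [pred A : {ffun I -> {set Q}} | [forall c, chain_set (A c) && (#|A c| == n c)]
     && [forall p, #|[set c | p \in A c]| == m p]].

(** Choosing a chain for every factor, the exponent of p is the number of
    chosen chains that contain p. *)
Lemma coef_prod_esfP (I : finType) (n : I -> nat) m :
  ((\prod_c esfP Q (n c))@_m = (#|chain_family n m|)%:Z)%R.
Proof.
under eq_bigr do rewrite esfP_chain_sets.
rewrite bigA_distr_big_dep /= raddf_sum /= -[RHS]natz -sum1_card natr_sum /=.
rewrite big_mkcond [RHS]big_mkcond /=; apply: eq_bigr => A _.
rewrite malg_prodU mcoeffU1.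
set b := [forall c, chain_set (A c) && (#|A c| == n c)].
rewrite (_ : (A \in family _) = b); last first.
  by apply/familyP/forallP => h c; apply: h.
rewrite (_ : (A \in chain_family n m) =
  b && [forall p, #|[set c | p \in A c]| == m p]); last by rewrite inE.
case: b => //=; rewrite -mulrb; congr (nat_of_bool _)%:R%R.
apply/cmP/forallP => h p; [rewrite -h|apply/esym/eqP; rewrite -(eqP (h p))];
  rewrite cm_prod -sum1_card big_mkcond; apply/eqP/eq_bigr => c _;
  by rewrite inE msetE; case: (_ \in _).
Qed.

End ChainSets.

Lemma card_transpose (I J : finType) (n : I -> nat) (m : J -> nat) :
  #|[pred A : {ffun I -> {set J}} | [forall i, #|A i| == n i] &&
      [forall j, #|[set i | j \in A i]| == m j]]| =
  #|[pred B : {ffun J -> {set I}} | [forall j, #|B j| == m j] &&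
      [forall i, #|[set j | i \in B j]| == n i]]|.
Proof.
pose tr (I' J' : finType) (A : {ffun I' -> {set J'}}) : {ffun J' -> {set I'}} :=
  [ffun j => [set i | j \in A i]].
have trK I' J' : cancel (@tr I' J') (@tr J' I').
  by move=> A; apply/ffunP => i; apply/setP => j; rewrite ffunE inE ffunE inE.
rewrite -[LHS](card_image (can_inj (@trK I J))); apply: eq_card => B.
rewrite -[B](@trK J I) (mem_image (can_inj (@trK I J))) !inE trK andbC.
have e (I' J' : finType) (A : {ffun I' -> {set J'}}) j :
    [set i | j \in A i] = tr _ _ A j.
  by rewrite ffunE.
congr andb; apply: eq_forallb => x; first by rewrite e trK.
by congr (_ == _); apply: eq_card => y; rewrite inE ffunE inE.
Qed.

(** * Series restricted to finitely many variables *)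
Section Embedding.
Variable k : nat.
Implicit Types m : {cmonom 'I_k}.

Definition emb m : {cmonom nat} :=
  [cmonom oapp m 0 (insub i) | i in [fset val j | j : 'I_k]%fset]%M.

Definition restrict_cm (m : {cmonom nat}) : {cmonom 'I_k} :=
  [cmonom m (val i) | i in [fset j | j : 'I_k]%fset]%M.

Lemma embE m i : emb m i = oapp m 0 (insub i).
Proof.
rewrite /emb cmE fsfun_fun; case: ifP => // /negbT iP.
case: insubP => // j _ ji; case/imfsetP: iP.
by exists j.
Qed.

Lemma emb_ord m (i : 'I_k) : emb m i = m i.
Proof. by rewrite embE valK. Qed.

Lemma emb_out m i : k <= i -> emb m i = 0.
Proof. by move=> ki; rewrite embE insubF // ltnNge ki. Qed.

Lemma restrict_cmE (m : {cmonom nat}) i : restrict_cm m i = m (val i).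
Proof.
rewrite /restrict_cm cmE fsfun_fun; case: ifP => // /negbT/imfsetP[].
by exists i.
Qed.

Lemma embK : cancel emb restrict_cm.
Proof. by move=> m; apply/eqP/cmP => i; rewrite restrict_cmE emb_ord. Qed.

Lemma emb_inj : injective emb.
Proof. exact: can_inj embK. Qed.

Lemma restrict_cmK (m : {cmonom nat}) :
  (forall i, k <= i -> m i = 0) -> emb (restrict_cm m) = m.
Proof.
move=> h; apply/eqP/cmP => i; have [ki|ik] := leqP k i.
  by rewrite emb_out ?h.
by rewrite -[i]/(val (Ordinal ik)) emb_ord restrict_cmE.
Qed.

Lemma embM m m' : emb (mmul m m') = mmul (emb m) (emb m').
Proof.
apply/eqP/cmP => i; rewrite cmM !embE; case: insub => [j|] //=.
by rewrite cmM.
Qed.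

Lemma emb1 : emb mone = mone.
Proof.
by apply/eqP/cmP => i; rewrite embE; case: insub => [j|] /=; rewrite !cm1.
Qed.

Lemma embU (i : 'I_k) : emb (ucm i) = ucm (val i).
Proof.
apply/eqP/cmP => j; rewrite embE cmU.
case: insubP => [j' _ <-|/negbTE jk] /=; first by rewrite cmU.
by case: eqP jk => // <-; rewrite ltn_ord.
Qed.

Lemma emb_factor p q m : mmul p q = emb m -> p = emb (restrict_cm p).
Proof.
move=> e; rewrite restrict_cmK // => i ki; apply/eqP.
have /eqP : mmul p q i = 0 by rewrite e emb_out.
by rewrite cmM addn_eq0 => /andP[].
Qed.

(** Setting the variables x_i with i >= k to 0 turns f into F.  This is stated
    coefficientwise, since the result need not be a polynomial for a general
    series f. *)
Definition restricts_to (f : series) (F : {malg int[{cmonom 'I_k}]}) :=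
  forall m, coef f (emb m) = (F@_m)%R.

(** Divisors of a monomial in the first k variables involve only these
    variables. *)
Lemma restricts_mul f g F G : restricts_to f F -> restricts_to g G ->
  restricts_to (f * g)%R (F * G)%R.
Proof.
move=> fF gG m.
pose D := (msupp F `|` msupp G `|`
  [fset restrict_cm p | p in mdivisors (emb m)])%fset.
have DF : (msupp F `<=` D)%fset by apply/fsubsetP => p; rewrite !inE => ->.
have DG : (msupp G `<=` D)%fset.
  by apply/fsubsetP => p; rewrite !inE => ->; rewrite orbT.
rewrite (mcoeffMlw _ DF DG) [LHS](@coef_mulE [fset emb p | p in D]%fset).
  rewrite big_imfset /=; last by move=> p q _ _; apply: emb_inj.
  apply: eq_bigr => p _; rewrite big_imfset /=.
    2: by move=> ? ? _ _; apply: emb_inj.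
  by apply: eq_bigr => q _; rewrite fF gG -embM (inj_eq emb_inj).
move=> p q e; have pd := mem_mdivisorsl p q; have qd := mem_mdivisorsr p q.
rewrite e in pd qd; apply/andP; split; apply/imfsetP => /=.
  exists (restrict_cm p); last exact: emb_factor e.
  by rewrite !inE; apply/orP; right; apply/imfsetP; exists p.
exists (restrict_cm q); last by rewrite mulmC in e; exact: emb_factor e.
by rewrite !inE; apply/orP; right; apply/imfsetP; exists q.
Qed.

Lemma restricts_one : restricts_to 1%R 1%R.
Proof.
move=> m; rewrite mcoeff1 [LHS]/(((emb m == mone)%:R)%R).
by rewrite -emb1 (inj_eq emb_inj).
Qed.

Lemma chain_set_ord (S : {set 'I_k}) : chain_set S.
Proof.
by apply/forall_inP => p _; apply/forall_inP => q _; apply: comparableT.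
Qed.

Lemma restricts_esf n : restricts_to (esf n) (esfP 'I_k n).
Proof.
move=> m; rewrite esfP_chain_sets raddf_sum /=.
under eq_bigr => S _ do rewrite mcoeffU1.
under eq_bigl do rewrite chain_set_ord.
pose S0 := [set i | m i != 0].
have msetI S : mset S = m -> S = S0.
  by move=> e; apply/setP => i; rewrite inE -e msetE; case: (i \in S).
have embS S : emb (mset S) = \big[mmul/mone]_(i in S) ucm (val i).
  rewrite /mset (big_morph emb embM emb1); apply: eq_bigr => i _; exact: embU.
have [mS0|mS0] := eqVneq (mset S0) m; last first.
  rewrite big1 => [|S _]; last first.
    by case: (mset S =P m) => // e; case/eqP: mS0; rewrite -(msetI _ e).
  rewrite [LHS]/(esf_coef _ _) /esf_coef; case: allP => // h; case/eqP: mS0.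
  apply/eqP/cmP => i; rewrite msetE inE; case: eqVneq => [-> //|mi].
  by have /= := h (val i); rewrite -cmE_neq0 emb_ord => /(_ mi)/eqP ->.
rewrite [LHS]/(esf_coef _ _) /esf_coef (_ : all _ _); last first.
  apply/allP => i /=; rewrite -cmE_neq0 embE; case: insubP => //= j _ _.
  by rewrite -mS0 msetE; case: (j \in S0).
rewrite -{1}mS0 embS mdeg_prod (eq_bigr _ (fun i _ => mdegU (val i))).
rewrite sum1_card /=.
have [nS|nS] := eqVneq #|S0| n.
  rewrite (bigD1 S0) /= ?nS ?eqxx // mS0 eqxx big1 ?addr0 // => S /andP[_ SS0].
  by case: (mset S =P m) SS0 => // /msetI ->; rewrite eqxx.
rewrite big1 // => S /eqP Sn; case: (mset S =P m) => // /msetI e.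
by rewrite -e Sn eqxx in nS.
Qed.

Lemma restricts_prod_esf (I : finType) (n : I -> nat) :
  restricts_to (\prod_c esf (n c))%R (\prod_c esfP 'I_k (n c))%R.
Proof.
elim/big_rec2: _ => [|c f F _ IH]; first exact: restricts_one.
exact: restricts_mul (restricts_esf _) IH.
Qed.

End Embedding.

(** A filling whose content only involves the first k variables takes its values
    below k, so that the sum over infinitely many fillings is a finite count. *)
Lemma coef_gen_series (V : finType) (A : classical_sets.set {ffun V -> nat}) k
    (m : {cmonom 'I_k}) :
  coef (gen_series A (fun f => monom_of f)) (emb m) =
    (#|[pred f : {ffun V -> 'I_k} |
        `[< A [ffun v => val (f v)] >] && (monom_of f == m)]|)%:Z%R.
Proof.
set B := [pred f | _]; pose h (f : {ffun V -> 'I_k}) := [ffun v => val (f v)].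
have hI : injective h.
  move=> f g e; apply/ffunP => v; apply: val_inj.
  by have /ffunP/(_ v) := e; rewrite !ffunE.
have hm f : monom_of (h f) = emb (monom_of f).
  rewrite /monom_of (big_morph (@emb k) (@embM k) (@emb1 k)).
  apply: eq_bigr => v _.
  by rewrite embU ffunE.
have hB f : f \in B -> A (h f) /\ monom_of (h f) = emb m.
  by rewrite inE => /andP[/asboolP Af /eqP <-].
rewrite /= (@fsbigE _ _ _ _ _ [seq h f | f in B]).
- rewrite big_image_cond /= -[RHS]natz -sum1_card natr_sum /=.
  apply: eq_big => [f|f /andP[/hB[_ ->] _]]; last by rewrite eqxx.
  by apply/andb_idr => /hB[Af _]; apply: classical_sets.mem_set.
- by rewrite map_inj_uniq ?enum_uniq.
- by move=> f /= /mapP[g]; rewrite mem_enum => /hB[Ag _] ->.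
move=> f Af; case: eqP => // mf; case/negP.
have fk v : f v < k.
  rewrite ltnNge; apply/negP => kf; have := monom_ofE f (f v).
  rewrite mf emb_out // => /esym/eqP; apply/negP; rewrite -lt0n.
  by apply/card_gt0P; exists v; rewrite inE.
pose g := [ffun v => Ordinal (fk v)].
have fE : f = h g by apply/ffunP => v; rewrite !ffunE.
rewrite fE; apply: image_f; rewrite inE -/(h g) -fE; apply/andP; split.
  exact/asboolP.
by rewrite -(inj_eq (@emb_inj k)) -hm -fE mf.
Qed.

Lemma three_plus_one_free_ord k : three_plus_one_free 'I_k.
Proof.
by case=> a [b [c [x [_ _ [/negP h _ _]]]]]; apply: h; apply: comparableT.
Qed.

Section SkewOrd.
Variables (la mu : intpart) (d k : nat).
Implicit Type T : {ffun Defs.skew la mu -> 'I_k}.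

Lemma cyl_tableau_ord T :
  is_cyl_tableau d [ffun b => val (T b)] <-> is_cyl_tableau d T.
Proof.
have fE r c : fill [ffun b => val (T b)] r c = omap val (fill T r c).
  by rewrite /fill; case: insub => [b|] //=; rewrite ffunE.
have gE r c : glue (part la 1) d (fill [ffun b => val (T b)]) r c =
    omap val (glue (part la 1) d (fill T) r c).
  by rewrite /glue !fE; case: ifP => // _; case: ifP.
have gS r c (x : 'I_k) : glue (part la 1) d (fill T) r c = Some x ->
    glue (part la 1) d (fill [ffun b => val (T b)]) r c = Some (val x).
  by rewrite gE => ->.
split=> -[ver hor]; split=> r c x y.
- by move=> /gS ex /gS ey; have := ver _ _ _ _ ex ey.
- by move=> /gS ex /gS ey; have := hor _ _ _ _ ex ey.
- rewrite !gE; case ex: (glue _ _ (fill T) r c) => [x'|] //= [<-].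
  by case ey: glue => [y'|] //= [<-]; apply: ver ex ey.
rewrite !gE; case ex: (glue _ _ (fill T) r c) => [x'|] //= [<-].
by case ey: glue => [y'|] //= [<-]; apply: hor ex ey.
Qed.

Lemma coef_cyl_schur (m : {cmonom 'I_k}) :
  coef (cyl_schur la mu d) (emb m) =
    (#|[pred T : {ffun Defs.skew la mu -> 'I_k} |
        `[< is_cyl_tableau d T >] && (monom_of T == m)]|)%:Z%R.
Proof.
rewrite coef_gen_series; congr Posz; apply: eq_card => T; rewrite !inE.
by congr andb; apply/asbool_equiv_eq/cyl_tableau_ord.
Qed.

End SkewOrd.

(** * The expansion of the cylindric Schur function *)

Lemma coefD (f g : series) m : coef (f + g)%R m = (coef f m + coef g m)%R.
Proof. by []. Qed.

Lemma coef_sum (I : Type) (r : seq I) (P : pred I) (F : I -> series) m :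
  coef (\sum_(i <- r | P i) F i)%R m = (\sum_(i <- r | P i) coef (F i) m)%R.
Proof. exact: (big_morph (coef^~ m) (id1 := 0%R) (op1 := +%R)). Qed.

Lemma coef_mulrz (f : series) z m : coef (f *~ z)%R m = (coef f m * z)%R.
Proof.
have cn n : coef (f *+ n)%R m = (coef f m *+ n)%R.
  by elim: n => // n IH; rewrite !mulrS coefD IH.
case: z => n; first by rewrite -pmulrn cn -mulr_natr natz.
rewrite NegzE mulrNz mulrN -pmulrn; congr (- _)%R.
by rewrite -natz mulr_natr; apply: cn.
Qed.

Lemma symfun_series_sum (I : Type) (r : seq I) (P : pred I) (F : I -> symfun) :
  symfun_series (\sum_(i <- r | P i) F i)%R =
    (\sum_(i <- r | P i) symfun_series (F i))%R.
Proof. exact: (raddf_sum (\val : {rmorphism symfun -> series})). Qed.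

Lemma symfun_series_mulrz (f : symfun) z :
  symfun_series (f *~ z)%R = (symfun_series f *~ z)%R.
Proof. exact: (raddfMz (\val : {rmorphism symfun -> series})). Qed.

Lemma coef_prod_esf (I : finType) (n : I -> nat) k (m : {cmonom 'I_k}) :
  coef (symfun_series (\prod_c esf (n c)))%R (emb m) =
    ((\prod_c esfP 'I_k (n c))@_m)%R.
Proof. exact: restricts_prod_esf. Qed.

Lemma emb_surj (m : {cmonom nat}) : exists k (m' : {cmonom 'I_k}), m = emb m'.
Proof.
exists (\max_(i <- finsupp m) i).+1, (restrict_cm _ m).
rewrite restrict_cmK // => i im.
apply/eqP; rewrite cmE_eq0; apply: contraL im => im.
by rewrite -leqNgt (@leq_bigmax_seq _ _ xpredT id).
Qed.

(** Any monomial lives in the first k variables for some k, and there the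
    coefficients are computed by [jacobi_trudi_tableaux] for the total order
    'I_k. *)
Lemma cyl_schur_jacobi_trudi (la mu : intpart) d : cylindric_shape la mu d ->
  cyl_schur la mu d =
    symfun_series (jacobi_trudi d (@col_start la mu) (@col_end la) esf).
Proof.
move=> shape; apply/seriesP => m; have [k [m' ->]] := emb_surj m.
rewrite coef_cyl_schur -(jacobi_trudi_tableaux shape) //; last first.
  exact: three_plus_one_free_ord.
rewrite symfun_series_sum coef_sum raddf_sum /=; apply: eq_bigr => n _.
by rewrite symfun_series_mulrz coef_mulrz raddfMz /= coef_prod_esf mulrzz.
Qed.

(** * The chromatic symmetric function *)

Definition xpow k (n : 'I_k -> nat) : {cmonom 'I_k} :=
  [cmonom n i | i in [fset i | i : 'I_k]%fset]%M.

Lemma xpowE k (n : 'I_k -> nat) i : xpow n i = n i.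
Proof.
rewrite /xpow cmE fsfun_fun; case: ifP => // /negbT/imfsetP[].
by exists i.
Qed.

Lemma coef_prod_esf_card (I : finType) k (n : I -> nat) (nu : 'I_k -> nat) :
  coef (symfun_series (\prod_c esf (n c)))%R (emb (xpow nu)) =
    (#|[pred A : {ffun I -> {set 'I_k}} | [forall c, #|A c| == n c] &&
       [forall j, #|[set c | j \in A c]| == nu j]]|)%:Z%R.
Proof.
rewrite coef_prod_esf coef_prod_esfP; congr Posz; apply: eq_card => A.
rewrite !inE; congr andb; apply: eq_forallb => c; first by rewrite chain_set_ord.
by rewrite xpowE.
Qed.

(** Transposition of 0/1 matrices with prescribed row and column sums. *)
Lemma coef_prod_esf_sym k l (n : 'I_l -> nat) (nu : 'I_k -> nat) :
  coef (symfun_series (\prod_c esf (n c)))%R (emb (xpow nu)) =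
  coef (symfun_series (\prod_j esf (nu j)))%R (emb (xpow n)).
Proof. by rewrite !coef_prod_esf_card card_transpose. Qed.

Lemma uPE (disp : Order.disp_t) (P : finPOrderType disp) (p : P) : uP P p = 1.
Proof. by rewrite monom_ofE -(card1 p); apply: eq_card => q; rewrite !inE. Qed.
(** The color classes of a proper coloring of the incomparability graph are
    chains, and they contain every element of P exactly once. *)
Lemma coef_chromatic (disp : Order.disp_t) (P : finPOrderType disp) l
    (n : 'I_l -> nat) :
  coef (chromatic_series (inc P)) (emb (xpow n)) =
    ((\prod_c esfP P (n c))@_(uP P))%R.
Proof.
rewrite coef_gen_series coef_prod_esfP; congr Posz.
pose h (f : {ffun P -> 'I_l}) : {ffun 'I_l -> {set P}} :=
  [ffun c => [set p | f p == c]].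
have hI : injective h.
  move=> f g e; apply/ffunP => p; apply/eqP.
  have /ffunP/(_ (g p))/setP/(_ p) := e.
  by rewrite !ffunE !inE eqxx.
rewrite -[LHS](card_imset _ hI); apply: eq_card => A.
have chainE f : [forall c, chain_set (h f c)] =
    `[< proper_coloring (inc P) [ffun v => val (f v)] >].
  apply/forallP/asboolP => [hc p q pq|hf c].
    rewrite !ffunE; apply: contraTN pq => /eqP/val_inj e.
    have /forall_inP/(_ p) := hc (f q); rewrite ffunE inE e eqxx => /(_ isT).
    by move=> /forall_inP/(_ q); rewrite inE eqxx /inc negbK => /(_ isT).
  apply/forall_inP => p; rewrite ffunE inE => /eqP pc.
  apply/forall_inP => q; rewrite inE => /eqP qc.
  apply: contraT => pq; have := hf p q pq; rewrite !ffunE pc qc eqxx.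
  by [].
have sizeE f : [forall c, #|h f c| == n c] = (monom_of f == xpow n).
  have e c : monom_of f c = #|h f c|.
    by rewrite monom_ofE ffunE cardsE; apply: eq_card => p; rewrite !inE.
  apply/forallP/cmP => hf c; first by rewrite e xpowE; apply/eqP.
  by rewrite -e hf xpowE.
have splitE f : [forall c, chain_set (h f c) && (#|h f c| == n c)] =
    [forall c, chain_set (h f c)] && [forall c, #|h f c| == n c].
  apply/forallP/andP => [hf|[/forallP h1 /forallP h2] c]; last by rewrite h1 h2.
  by split; apply/forallP => c; case/andP: (hf c).
apply/imsetP/idP => [[f]|].
  rewrite !inE => fP ->; rewrite splitE chainE sizeE fP /=.
  apply/forallP => p; rewrite uPE -(card1 (f p)); apply/eqP/eq_card => c.
  by rewrite !inE ffunE inE eq_sym.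
rewrite inE => /andP[cA /forallP uA].
have ex p : exists c, [set c | p \in A c] = [set c].
  by apply/cards1P; have := uA p; rewrite uPE.
have [f fE] := choice ex.
have AE : A = h [ffun p => f p].
  apply/ffunP => c; apply/setP => p; rewrite ffunE inE ffunE.
  by have /setP/(_ c) := fE p; rewrite !inE eq_sym => ->.
exists [ffun p => f p] => //; rewrite inE -chainE -sizeE.
by rewrite -splitE -AE.
Qed.

Lemma standard_monom (disp : Order.disp_t) (P : finPOrderType disp)
    (D : {fset nat * nat}) (T : {ffun D -> P}) :
  standard T <-> monom_of T = uP P.
Proof.
split=> [st|e p].
  apply/eqP/cmP => p; rewrite uPE monom_ofE; have [b [Tb ub]] := st p.
  rewrite -(card1 b); apply: eq_card => b'; rewrite !inE.
  by apply/eqP/eqP => [/ub ->|->].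
have : monom_of T p = 1 by rewrite e uPE.
rewrite monom_ofE => /mem_card1[b bE]; exists b; split.
  by have := bE b; rewrite !inE eqxx => /eqP.
by move=> b' Tb'; have := bE b'; rewrite !inE Tb' eqxx => /esym/eqP.
Qed.

Lemma coef_msf (nu nu' : intpart) :
  coef (msf nu') (emb (xpow (fun j : 'I_(size nu) => nth 0 nu j))) =
    ((nu == nu')%:R)%R.
Proof.
rewrite /=; congr (nat_of_bool _)%:R%R.
set m := emb _.
have mE i : m i = nth 0 nu i.
  have [ki|ik] := leqP (size nu) i; first by rewrite emb_out // nth_default.
  by rewrite -[i in LHS]/(val (Ordinal ik)) emb_ord xpowE.
have /andP[snu nu0] := partsP nu; have /andP[snu' _] := partsP nu'.
have pm : perm_eq [seq m i | i <- finsupp m] nu.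
  have ps : perm_eq (finsupp m) (iota 0 (size nu)).
    apply: uniq_perm; rewrite ?iota_uniq ?fset_uniq // => i.
    rewrite -cmE_neq0 mE mem_iota add0n /=.
    have [ki|ik] := leqP (size nu) i; first by rewrite nth_default.
    by apply: contra nu0 => /eqP <-; rewrite mem_nth.
  rewrite (perm_trans (perm_map m ps)) // (eq_map mE) map_nth_iota0 //.
  by rewrite take_size.
rewrite (permPl pm); apply/idP/eqP => [pnu|-> //].
apply: val_inj; apply: (sorted_eq _ _ snu snu' pnu).
  exact: rev_trans leq_trans.
by move=> x y; rewrite /geq /= andbC => /anti_leq.
Qed.

Local Open Scope ring_scope.

(** * The theorem *)
Lemma esf_partE (nu : intpart) :
  esf_part nu = \prod_(j < size nu) esf (nth 0%N nu j).
Proof. by rewrite /esf_part (big_nth 0%N) big_mkord. Qed.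

Theorem corollary2p7 (disp : Order.disp_t) (P : finPOrderType disp)
  (P_free : three_plus_one_free P)
  (la mu : intpart) (d : nat) (shape : cylindric_shape la mu d)
  (a : {fsfun intpart -> int with 0})
  (a_def : cyl_schur la mu d = \sum_(nu <- finsupp a) msf nu *~ a nu)
  (c : {fsfun intpart -> int with 0})
  (c_def : chromatic_series (inc P) =
             \sum_(nu <- finsupp c) symfun_series (esf_part nu) *~ c nu)
  (psi : {rmorphism symfun -> {malg int[{cmonom P}]}})
  (psi_def : forall k : nat, psi (esf k) = esfP P k) :
  \sum_(nu <- finsupp a) a nu * c nu = (cyl_schurP psi la mu d)@_(uP P) /\
  (cyl_schurP psi la mu d)@_(uP P) = (nb_standard_cyl P la mu d)%:Z.
Proof.
pose jt := jacobi_trudi d (@col_start la mu) (@col_end la).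
have S_jt : cyl_schur la mu d = symfun_series (jt _ esf).
  exact: cyl_schur_jacobi_trudi.
have psi_jt : cyl_schurP psi la mu d = jt _ (esfP P).
  rewrite /cyl_schurP S_jt (valKd 0 (jt _ esf)) rmorph_jacobi_trudi.
  by congr jt; apply/funext => k; apply: psi_def.
split; last first.
  rewrite psi_jt jacobi_trudi_tableaux //; congr Posz; apply: eq_card => T.
  rewrite !inE; apply/andP/asboolP => [[/asboolP cT /eqP mT]|[cT sT]].
    by split=> //; apply/standard_monom.
  by split; [apply/asboolP | apply/eqP/standard_monom].
(* As m_nu is the only monomial symmetric function containing x^nu, the
   coefficient a nu is the coefficient of x^nu. *)
pose x (nu : intpart) := emb (xpow (fun j : 'I_(size nu) => nth 0%N nu j)).
have aE nu : a nu = coef (cyl_schur la mu d) (x nu).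
  rewrite a_def coef_sum; under eq_bigr do rewrite coef_mulrz coef_msf.
  have [nua|nua] := boolP (nu \in finsupp a).
    rewrite (big_fsetD1 nu) //= eqxx mul1r big_seq big1 ?addr0 // => nu'.
    by rewrite in_fsetD1 eq_sym => /andP[/negbTE -> _]; rewrite mul0r.
  rewrite (fsfun_dflt nua) big_seq big1 // => nu' nu'a.
  by case: eqP nua => [->|_ _]; rewrite ?nu'a ?mul0r.
have -> : \sum_(nu <- finsupp a) a nu * c nu = \sum_(nu <- finsupp c) a nu * c nu.
  pose D := (finsupp a `|` finsupp c)%fset.
  transitivity (\sum_(nu <- D) a nu * c nu).
    apply: big_fset_incl => [|nu _ nua]; first exact: fsubsetUl.
    by rewrite (fsfun_dflt nua) mul0r.
  apply/esym/big_fset_incl => [|nu _ nuc]; first exact: fsubsetUr.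
  by rewrite (fsfun_dflt nuc) mulr0.
rewrite psi_jt raddf_sum /=.
(* After expanding a nu by the signed sum, exchange the two sums: the sum over
   nu becomes a coefficient of X_inc(P) by the symmetry of the coefficients. *)
transitivity (\sum_(nu <- finsupp c) \sum_(n : {ffun 'I_(part la 1) ->
    'I_(nboxes (@col_start la mu) (@col_end la)).+1})
  coef (symfun_series (\prod_i esf (n i))) (x nu) *
  sgn d (@col_start la mu) (@col_end la) (fun i => n i) * c nu).
  apply: eq_bigr => nu _; rewrite aE S_jt symfun_series_sum coef_sum mulr_suml.
  by apply: eq_bigr => n _; rewrite symfun_series_mulrz coef_mulrz.
rewrite exchange_big; apply: eq_bigr => n _ /=.
rewrite raddfMz /= -coef_chromatic c_def coef_sum -mulrzr mulr_suml.
apply: eq_bigr => nu _; rewrite coef_mulrz esf_partE -coef_prod_esf_sym intz.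
by rewrite mulrAC.
Qed.
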